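(* Let $\mathbb{R}^n$ be a Euclidean space with coordinates $x=(x_1,\ldots,x_n)$ and metric $g_{ij}=e^{2\xi}\delta_{ij}$, where $\xi=\sum_{i=1}^n\alpha_ix_i$, $\alpha_i\in\mathbb{R}$ and $n\geq 3$. The functions $$f=e^{\xi}, \quad \varphi=\frac{c_{1}}{2}e^{2\xi}-\frac{(2-m-n)}{2}\,\xi+c_{2} \quad \mbox{and} \quad \lambda=c_{1}+\frac{(2-m-n)}{2}e^{-2\xi}$$ satisfy on $\mathbb{R}^n$, for some constants $c_1$ and $c_2$, the equations $$Ric+\nabla^{2}\varphi=\lambda g+\frac{m}{f}\nabla^{2}f$$ and $$-2\lambda\, d\varphi + d\Big((2-m-n)\lambda + |\nabla\varphi|^{2} - \Delta\varphi - \frac{m}{f}\nabla\varphi(f)\Big)=0.$$ Moreover, the constant $\mu$ given by $$\mu=\lambda f^{2}+f\Delta f +(m-1)|\nabla f|^{2} -f\nabla\varphi(f)$$ is null. Then, for any complete Ricci flat Riemannian manifold $\mathbb{F}^m$, with $m>1$, the quadruple $(\mathbb{R}^n\times_f\mathbb{F}^m,g,\nabla\tilde\varphi,\tilde\lambda)$ is a gradient Ricci almost soliton warped product.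
   Context: Given Riemannian manifolds $(B^n,g_B)$ and $(\mathbb{F}^m,g_{\mathbb{F}})$ of dimensions $n$ and $m$ and a positive smooth function $f$ on $B$, the warped product $B^n\times_f\mathbb{F}^m$ is the product manifold $B\times\mathbb{F}$ endowed with the metric $g=\pi^{*}g_{B}+(f\circ\pi)^{2}\sigma^{*}g_{\mathbb{F}}$, where $\pi:B\times\mathbb{F}\to B$ and $\sigma:B\times\mathbb{F}\to\mathbb{F}$ are the canonical projections. For a smooth function $h$ on $B$, $\tilde h=h\circ\pi$ denotes its lift to the warped product. Here $B=\mathbb{R}^n$ with the metric $g_{ij}=e^{2\xi}\delta_{ij}$; in the quadruple, $g$ denotes the warped product metric and $\nabla\tilde\varphi$ is the gradient with respect to it. In the equations on $\mathbb{R}^n$, $g$ is the metric $g_{ij}=e^{2\xi}\delta_{ij}$, and $Ric$, the gradient $\nabla$, the Hessian $\nabla^2$, the Laplacian $\Delta=\mathrm{tr}\,\nabla^2$ and the norm $|\cdot|$ are taken with respect to it; $\nabla\varphi(f)=g(\nabla\varphi,\nabla f)$ is the derivative of $f$ in the direction $\nabla\varphi$. A complete Riemannian manifold $(M,g)$ is a Ricci almost soliton $(M,g,X,\lambda)$ if there exist a vector field $X$ and a smooth function $\lambda\in C^\infty(M)$ (the soliton function) with $Ric+\frac12\mathscr{L}_Xg=\lambda g$, where $\mathscr{L}$ is the Lie derivative. It is a gradient Ricci almost soliton $(M,g,\nabla\psi,\lambda)$ when $X=\nabla\psi$ for a smooth function $\psi$ on $M$ (the potential function), in which case the equation becomes $Ric+\nabla^2\psi=\lambda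 g$. A gradient Ricci almost soliton warped product is a gradient Ricci almost soliton whose underlying Riemannian manifold is a warped product.
   Formalization: Assumes α_1²+…+α_n²=1 (otherwise the first equation fails, except α=0 with c_1=(m+n−2)/2), and does not require the warped product to be complete in the soliton definition, since e^{2ξ}(|dx|²+g_F) is never complete for |α|=1. *)

(* Defs.v *)
From HB Require Import structures.
From mathcomp Require Import all_boot all_order all_algebra.
From mathcomp Require Import all_classical all_reals all_analysis.
Set Implicit Arguments.
Unset Strict Implicit.
Unset Printing Implicit Defensive.
Import Order.TTheory GRing.Theory Num.Theory numFieldNormedType.Exports.
Local Open Scope classical_set_scope.
Local Open Scope ring_scope.

(* MathComp-Analysis has no manifolds, so a Riemannian manifold is given by an
   atlas and a tensor by its family of components in the charts, subject to the
   usual transformation law.  Points, vectors and covectors of R^n are row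
   vectors; a metric is a matrix-valued function of the coordinates. *)

Section LocalTensorCalculus.
Variables (R : realType) (n : nat).
Implicit Types (u : 'rV[R]_n -> R) (g : 'rV[R]_n -> 'M[R]_n).
Implicit Types (X Y : 'rV[R]_n -> 'rV[R]_n) (x : 'rV[R]_n).

Definition partial (i : 'I_n) u x : R := 'D_(delta_mx 0 i) u x.

(* U is meant to be open. *)
Fixpoint Ck_on (k : nat) (U : set 'rV[R]_n) u : Prop :=
  (forall x, U x -> {for x, continuous u}) /\
  if k is k'.+1 then
    forall i, (forall x, U x -> derivable u x (delta_mx 0 i)) /\
              Ck_on k' U (partial i u)
  else True.

Definition smooth_on (U : set 'rV[R]_n) u : Prop := forall k, Ck_on k U u.

Definition dform u x : 'rV[R]_n := \row_i partial i u x.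

Definition inner g X Y x : R := (X x *m g x *m (Y x)^T) 0 0.

(* christoffel g k i j is Gamma^k_ij. *)
Definition christoffel g (k i j : 'I_n) x : R :=
  2^-1 * \sum_l invmx (g x) k l *
    (partial i (fun y => g y j l) x + partial j (fun y => g y i l) x
     - partial l (fun y => g y i j) x).

(* riemann g l k i j is the d_l component of R(d_i, d_j) d_k, where
   R(X, Y) = [nabla_X, nabla_Y] - nabla_[X, Y]. *)
Definition riemann g (l k i j : 'I_n) x : R :=
  partial i (christoffel g l j k) x - partial j (christoffel g l i k) x
  + \sum_p (christoffel g l i p x * christoffel g p j k x
            - christoffel g l j p x * christoffel g p i k x).

(* Ric(Y, Z) is the trace of X |-> R(X, Y) Z, positive on round spheres. *)
Definition ricci g x : 'M[R]_n := \matrix_(j, k) \sum_i riemann g i k i j x.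

Definition grad g u x : 'rV[R]_n := dform u x *m invmx (g x).

Definition hess g u x : 'M[R]_n :=
  \matrix_(i, j) (partial i (partial j u) x
                  - \sum_k christoffel g k i j x * partial k u x).

Definition laplacian g u x : R := \tr (invmx (g x) *m hess g u x).

(* (L_X g)_ij = X^k d_k g_ij + g_kj d_i X^k + g_ik d_j X^k. *)
Definition lie_metric X g x : 'M[R]_n :=
  \matrix_(i, j) \sum_k (X x 0 k * partial k (fun y => g y i j) x
                         + g x k j * partial i (fun y => X y 0 k) x
                         + g x i k * partial j (fun y => X y 0 k) x).

(* The differential of tau at x is v |-> v *m jac tau x. *)
Definition jac (tau : 'rV[R]_n -> 'rV[R]_n) x : 'M[R]_n :=
  \matrix_(i, j) partial i (fun y => tau y 0 j) x.

End LocalTensorCalculus.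

(* Raw data only; the axioms are in [riemannian_manifold] below.  Outside
   [cdom a] and its image, [coord a], [param a] and [gmat a] are irrelevant. *)
Record riemannian_data (R : realType) (m : nat) := RiemannianData {
  carrier :> topologicalType;
  chart : Type;
  cdom : chart -> set carrier;
  coord : chart -> carrier -> 'rV[R]_m;
  param : chart -> 'rV[R]_m -> carrier;
  gmat : chart -> 'rV[R]_m -> 'M[R]_m }.

Section Manifolds.
Variables (R : realType) (m : nat) (M : riemannian_data R m).

Definition cimage (a : chart M) : set 'rV[R]_m := coord a @` cdom a.

Definition overlap (a b : chart M) : set 'rV[R]_m :=
  coord a @` (cdom a `&` cdom b).

Definition transition (a b : chart M) : 'rV[R]_m -> 'rV[R]_m :=
  fun x => coord b (param a x).

Definition smooth_manifold : Prop :=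
  [/\ hausdorff_space M,
      @second_countable M,
      (forall p : M, exists a : chart M, cdom a p),
      (forall a : chart M,
        [/\ open (cdom a), open (cimage a),
            (forall p, cdom a p -> param a (coord a p) = p),
            (forall p, cdom a p -> {for p, continuous (coord a)}) &
            (forall x, cimage a x -> {for x, continuous (param a)})]) &
      (forall (a b : chart M) (j : 'I_m),
        smooth_on (overlap a b) (fun x => transition a b x 0 j))].

Definition riemannian_manifold : Prop :=
  [/\ smooth_manifold,
      (forall (a : chart M) (i j : 'I_m),
        smooth_on (cimage a) (fun x => gmat a x i j)),
      (forall (a : chart M) x, cimage a x ->
        (gmat a x)^T = gmat a x /\
        forall v : 'rV[R]_m, v != 0 -> 0 < (v *m gmat a x *m v^T) 0 0) &
      (forall (a b : chart M) x, overlap a b x ->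
        gmat a x = jac (transition a b) x *m gmat b (transition a b x)
                   *m (jac (transition a b) x)^T)].

Definition local_rep (h : M -> R) (a : chart M) : 'rV[R]_m -> R :=
  fun x => h (param a x).

Definition smooth_fun (h : M -> R) : Prop :=
  forall a : chart M, smooth_on (cimage a) (local_rep h a).

Definition smooth_vector_field
    (X : chart M -> 'rV[R]_m -> 'rV[R]_m) : Prop :=
  (forall (a : chart M) (i : 'I_m),
    smooth_on (cimage a) (fun x => X a x 0 i)) /\
  (forall (a b : chart M) x, overlap a b x ->
    X b (transition a b x) = X a x *m jac (transition a b) x).

Definition gradient (h : M -> R) : chart M -> 'rV[R]_m -> 'rV[R]_m :=
  fun a => grad (gmat a) (local_rep h a).

Definition ricci_flat : Prop :=
  forall (a : chart M) x, cimage a x -> ricci (gmat a) x = 0.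

Definition geodesic (gamma : R -> M) : Prop :=
  continuous gamma /\
  forall (a : chart M) (t : R), cdom a (gamma t) ->
    let c := fun (k : 'I_m) (s : R) => coord a (gamma s) 0 k in
    forall k : 'I_m,
      [/\ derivable (c k) t 1, derivable (derive1 (c k)) t 1 &
          derive1 (derive1 (c k)) t
          + \sum_i \sum_j christoffel (gmat a) k i j (coord a (gamma t))
                          * derive1 (c i) t * derive1 (c j) t = 0].

(* Geodesic completeness: every initial velocity v at p is that of a geodesic
   defined on the whole line. *)
Definition complete : Prop :=
  forall (p : M) (a : chart M) (v : 'rV[R]_m), cdom a p ->
    exists gamma : R -> M,
      [/\ geodesic gamma, gamma 0 = p &
          forall k : 'I_m,
            derive1 (fun s : R => coord a (gamma s) 0 k) 0 = v 0 k].

(* Ric + (1/2) L_X g = lambda g.  Completeness is deliberately not a part of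
   this notion: the soliton on R^n x_f F for f = e^xi and the metric
   e^(2 xi) delta on R^n is never complete when xi is a nonzero linear form. *)
Definition ricci_almost_soliton
    (X : chart M -> 'rV[R]_m -> 'rV[R]_m) (lambda : M -> R) : Prop :=
  [/\ riemannian_manifold, smooth_vector_field X, smooth_fun lambda &
      forall (a : chart M) x, cimage a x ->
        ricci (gmat a) x + 2^-1 *: lie_metric (X a) (gmat a) x
        = local_rep lambda a x *: gmat a x].

Definition gradient_ricci_almost_soliton (psi lambda : M -> R) : Prop :=
  smooth_fun psi /\ ricci_almost_soliton (gradient psi) lambda.

End Manifolds.

Section WarpedProducts.
Variables (R : realType) (n m : nat).
Variables (B : riemannian_data R n) (F : riemannian_data R m) (f : B -> R).

(* pi^* g_B + (f o pi)^2 sigma^* g_F, in the product charts. *)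
Definition warped_product : riemannian_data R (n + m) :=
  @RiemannianData R (n + m) (B * F)%type (chart B * chart F)%type
    (fun ab => cdom ab.1 `*` cdom ab.2)
    (fun ab p => row_mx (coord ab.1 p.1) (coord ab.2 p.2))
    (fun ab z => (param ab.1 (lsubmx z), param ab.2 (rsubmx z)))
    (fun ab z => block_mx (gmat ab.1 (lsubmx z)) 0
                          0 (f (param ab.1 (lsubmx z)) ^+ 2
                             *: gmat ab.2 (rsubmx z))).

Definition lift_base (h : B -> R) : warped_product -> R := fun p => h p.1.

Definition gradient_ricci_almost_soliton_warped_product
    (psi lambda : warped_product -> R) : Prop :=
  [/\ riemannian_manifold B, riemannian_manifold F, smooth_fun f,
      (forall p : B, 0 < f p) &
      @gradient_ricci_almost_soliton R (n + m) warped_product psi lambda].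

End WarpedProducts.

Section ConformalSpace.
Variables (R : realType) (n : nat) (xi : 'rV[R]_n -> R).

Definition conformal_metric (x : 'rV[R]_n) : 'M[R]_n :=
  (expR (2 * xi x))%:M.

(* R^n with its identity chart. *)
Definition conformal_space : riemannian_data R n :=
  @RiemannianData R n 'rV[R]_n unit
    (fun=> setT) (fun=> id) (fun=> id) (fun=> conformal_metric).

End ConformalSpace.

(* Main.v *)
Require Import Defs.
From HB Require Import structures.
From mathcomp Require Import all_boot all_order all_algebra.
From mathcomp Require Import all_classical all_reals all_analysis.
From mathcomp Require Import ring lra.
Import Order.TTheory GRing.Theory Num.Theory numFieldNormedType.Exports.
Set Implicit Arguments.
Unset Strict Implicit.
Unset Printing Implicit Defensive.
Local Open Scope classical_set_scope.
Local Open Scope ring_scope.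

(** All four claims are instances of one conformal computation.  Put N = n for
    the metric g on R^n, N = n + m for the warped metric.  The first is exp (2 xi)
    times the Euclidean metric; and since f = exp xi, the second is exp (2 xi)
    times the Riemannian product h of Euclidean R^n with F.  In both cases
    a = d xi is a constant covector which is parallel and of norm 1 for the
    unscaled metric h, and h is Ricci flat ([unit_parallel], [ricci_flat_sum]).

    The classical formulas for a conformal change then lose their second order
    terms in xi.  For u a function of xi ([ricci_exp_conformal], [hess_radial],
    [laplacian_radial], [inner_grad_radial]):
      Ric(exp (2 xi) h) = Ric(h) + (N - 2) (a tensor a - h),
      Hess u = (u'' - 2 u') a tensor a + u' h,
      Laplacian of u = exp (- 2 xi) (u'' + (N - 2) u'),
      <grad u, grad v> = exp (- 2 xi) u' v',
    the last three being taken with respect to exp (2 xi) h.  With the given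
    potential, u' = c1 exp (2 xi) - (2 - m - n) / 2 and u'' = 2 c1 exp (2 xi), so
    that Hess u has the rank one part (2 - m - n) a tensor a: this cancels the one
    of Ric exactly when N = n + m, and the coefficient of h that remains is
    lambda exp (2 xi) ([soliton_equation]).  On R^n the defect is
    m (h - a tensor a), that is (m / f) Hess f.  The other two equations on R^n
    become identities between rational functions of exp xi.

    What remains is that the objects on the warped product are legitimate.  A
    warped product of Riemannian manifolds is a Riemannian manifold
    ([riemannian_manifold_warped]); the gradient of the lifted potential is, in
    every product chart, a function of xi times the constant vector (alpha, 0),
    hence a smooth vector field ([smooth_gradient_psi]); and half the Lie
    derivative of the metric along it is the Hessian of the potential
    ([lie_metric_grad_radial]). *)

(** * Directional derivatives *)

(** The rules below are stated for explicit lambda-abstractions, so that the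
    derivative of a formula is found by composing their proof terms along the
    shape of the formula. *)
Section DirectionalDerivatives.
Variable R : realType.

(** The difference quotient of u \o l in the direction v is, term by term, that
    of u in the direction l v; hence no differentiability of u is needed, which
    matters because [smooth_on] only provides derivatives along the axes. *)
Lemma derive_comp_linear (V W : normedModType R) (l : V -> W) (u : W -> R) x v :
  linear l ->
  'D_v (u \o l) x = 'D_(l v) u (l x) /\
  (derivable u (l x) (l v) -> derivable (u \o l) x v).
Proof.
move=> hl.
have E : (fun h : R => h^-1 *: (((u \o l) \o shift x) (h *: v) - (u \o l) x))
  = (fun h => h^-1 *: ((u \o shift (l x)) (h *: l v) - u (l x))).
  apply/funext => h; rewrite /shift /=; congr (_ *: (u _ - _)); exact: hl.
by split; rewrite /derivable /derive E.
Qed.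

Lemma is_derive_comp_linear (V W : normedModType R) (l : V -> W)
    (u : W -> R) (x v : V) (du : R) : linear l ->
  is_derive (l x) (l v) u du -> is_derive x v (u \o l) du.
Proof.
move=> hl [d1 <-]; have [d2 d3] := derive_comp_linear u x v hl.
by split; [exact: d3 | exact: d2].
Qed.

Lemma is_derive1_dir (u : R -> R) (t s du : R) :
  is_derive t 1 u du -> is_derive t s u (s * du).
Proof.
case=> /derivable1_diffP u1 u2; split; first exact: diff_derivable.
rewrite deriveE// deriv1E; last exact/derivable1_diffP.
by rewrite derive1E u2.
Qed.

Lemma is_deriveV (V : normedModType R) (u : V -> R) (x v : V) (du : R) :
  u x != 0 -> is_derive x v u du ->
  is_derive x v (fun y => (u y)^-1) (- (u x) ^- 2 * du).
Proof.
move=> ux0 [du1 <-]; split; first exact: derivableV.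
exact: deriveV.
Qed.

Lemma is_derive_mul (V : normedModType R) (u w : V -> R) (x v : V) (du dw : R) :
  is_derive x v u du -> is_derive x v w dw ->
  is_derive x v (fun y => u y * w y) (du * w x + u x * dw).
Proof.
move=> hu hw; apply: (@is_derive_eq _ _ _ (u * w)).
by rewrite addrC -[du * _]mulrC.
Qed.

Lemma is_derive_add (V : normedModType R) (u w : V -> R) (x v : V) (du dw : R) :
  is_derive x v u du -> is_derive x v w dw ->
  is_derive x v (fun y => u y + w y) (du + dw).
Proof. by move=> hu hw; apply: (@is_deriveD _ _ _ u w). Qed.

Lemma is_derive_opp (V : normedModType R) (u : V -> R) (x v : V) (du : R) :
  is_derive x v u du -> is_derive x v (fun y => - u y) (- du).
Proof. by move=> hu; apply: (@is_deriveN _ _ _ u). Qed.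

Lemma is_derive_const (V : normedModType R) (c : R) (x v : V) :
  is_derive x v (fun=> c) 0.
Proof. exact: is_derive_cst. Qed.

Lemma is_derive_bigsum (V : normedModType R) (I : finType) (u : I -> V -> R)
    (x v : V) (du : I -> R) :
  (forall i, is_derive x v (u i) (du i)) ->
  is_derive x v (fun y => \sum_i u i y) (\sum_i du i).
Proof.
move=> hu; elim: (index_enum I) => [|i s IH].
  rewrite big_nil (_ : (fun _ => _) = cst 0) ; first exact: is_derive_cst.
  by apply/funext => y; rewrite big_nil.
rewrite big_cons (_ : (fun _ => _) = (fun y => u i y + \sum_(j <- s) u j y)).
  exact: is_derive_add.
by apply/funext => y; rewrite big_cons.
Qed.

Lemma is_derive_expR_comp (V : normedModType R) (u : V -> R) (x v : V) (du : R) :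
  is_derive x v u du ->
  is_derive x v (fun y => expR (u y)) (du * expR (u x)).
Proof.
(* Restrict to the line h |-> h v + x and use the one-variable chain rule. *)
have line (w : V -> R) d : is_derive x v w d <->
    is_derive (0 : R) (1 : R) (fun h : R => w (h *: v + x)) d.
  have E : (fun h : R => h^-1 *: (((fun h => w (h *: v + x)) \o shift 0) (h *: 1)
                                  - w (0 *: v + x)))
    = (fun h => h^-1 *: ((w \o shift x) (h *: v) - w x)).
    by apply/funext => h /=; rewrite addr0 scale0r add0r [_%:A]mulr1.
  by split=> -[d1 d2]; split; move: d1 d2; rewrite /derivable /derive E.
move=> /line hu; apply/line.
have := @is_derive1_comp R expR (fun h : R => u (h *: v + x)) 0 (expR (u x)) du.
rewrite scale0r add0r mulrC; exact.
Qed.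

End DirectionalDerivatives.

(** * Closure properties of smooth functions *)

Section SmoothFunctions.
Variables (R : realType) (n : nat).
Implicit Types (u v : 'rV[R]_n -> R) (U : set 'rV[R]_n).

Lemma open_near_eq (U : set 'rV[R]_n) (T : Type) (u v : 'rV[R]_n -> T) x :
  open U -> (forall y, U y -> u y = v y) -> U x -> {near x, u =1 v}.
Proof. by move=> oU uv Ux; apply: filterS (open_nbhs_nbhs (conj oU Ux)). Qed.

Lemma is_derive_open_eq U u v x w (d : R) : open U -> (forall y, U y -> u y = v y) ->
  U x -> is_derive x w u d -> is_derive x w v d.
Proof. by move=> oU uv Ux; apply: near_eq_is_derive; exact: open_near_eq uv Ux. Qed.

Lemma partial_open_eq U u v i x : open U -> (forall y, U y -> u y = v y) -> U x ->
  partial i u x = partial i v x.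
Proof. by move=> oU uv Ux; apply: near_eq_derive; exact: open_near_eq uv Ux. Qed.

Lemma partialE i u x (d : R) : is_derive x (delta_mx 0 i) u d -> partial i u x = d.
Proof. by case. Qed.

Lemma continuous_open_eq U u v x : open U -> (forall y, U y -> u y = v y) -> U x ->
  {for x, continuous u} -> {for x, continuous v}.
Proof.
move=> oU uv Ux cu; have vx := uv x Ux.
change (v @ x --> v x); rewrite -vx; apply: cvg_trans cu.
exact: (@near_eq_cvg _ _ (nbhs x) _ _ _ (open_near_eq oU uv Ux)).
Qed.

Lemma Ck_open_eq k U u v : open U -> (forall y, U y -> u y = v y) ->
  Ck_on k U u -> Ck_on k U v.
Proof.
move=> oU; elim: k u v => [|k IH] u v uv /= [cu du]; split=> //.
- by move=> x Ux; exact: continuous_open_eq uv Ux (cu x Ux).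
- by move=> x Ux; exact: continuous_open_eq uv Ux (cu x Ux).
move=> i; have [di pi] := du i; split=> [x Ux|].
  by apply: near_eq_derivable (di x Ux); exact: open_near_eq uv Ux.
by apply: IH pi => y Uy; exact: partial_open_eq uv Uy.
Qed.

Lemma CkS k U u : Ck_on k.+1 U u -> Ck_on k U u.
Proof.
elim: k u => [|k IH] u [cu du]; split=> // i.
have [di pi] := du i; split => //; exact: IH.
Qed.

Lemma Ck_cont k U u x : Ck_on k U u -> U x -> {for x, continuous u}.
Proof. by case: k => [|k] [cu _]; apply: cu. Qed.

(** The induction step shared by the closure properties below: they only have
    to exhibit the partial derivatives on U, since [partial] itself is
    uninformative outside U. *)
Lemma CkS_intro k U u (du : 'I_n -> 'rV[R]_n -> R) : open U ->
  (forall x, U x -> {for x, continuous u}) ->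
  (forall i x, U x -> is_derive x (delta_mx 0 i) u (du i x)) ->
  (forall i, Ck_on k U (du i)) -> Ck_on k.+1 U u.
Proof.
move=> oU cu hd hC; split=> // i; split=> [x Ux|].
  by case: (hd i x Ux).
apply: Ck_open_eq (hC i) => // y Uy; apply/esym/partialE; exact: hd.
Qed.

Lemma CkS_is_derive k U u i x : Ck_on k.+1 U u -> U x ->
  is_derive x (delta_mx 0 i) u (partial i u x).
Proof. by case=> _ /(_ i)[h _] Ux; split => //; exact: h. Qed.

Lemma CkS_partial k U u i : Ck_on k.+1 U u -> Ck_on k U (partial i u).
Proof. by case=> _ /(_ i)[]. Qed.

Lemma Ck_cst k U (c : R) : open U -> Ck_on k U (fun=> c).
Proof.
move=> oU; elim: k c => [|k IH] c; first by split=> // x _; apply: cst_continuous.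
apply: (@CkS_intro _ _ _ (fun _ _ => 0)) => //.
by move=> x _; apply: cst_continuous.
Qed.

Lemma CkD k U u v : open U -> Ck_on k U u -> Ck_on k U v ->
  Ck_on k U (fun x => u x + v x).
Proof.
move=> oU; elim: k u v => [|k IH] u v hu hv.
by split=> // x Ux; apply: (continuousD (Ck_cont hu Ux) (Ck_cont hv Ux)).
apply: (@CkS_intro _ _ _ (fun i x => partial i u x + partial i v x)) => //.
- by move=> x Ux; apply: (continuousD (Ck_cont hu Ux) (Ck_cont hv Ux)).
- by move=> i x Ux; apply: is_derive_add; apply: CkS_is_derive Ux; eassumption.
- by move=> i; apply: IH; apply: CkS_partial.
Qed.

Lemma CkM k U u v : open U -> Ck_on k U u -> Ck_on k U v ->
  Ck_on k U (fun x => u x * v x).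
Proof.
move=> oU; elim: k u v => [|k IH] u v hu hv.
  by split=> // x Ux; apply: (continuousM (Ck_cont hu Ux) (Ck_cont hv Ux)).
apply: (@CkS_intro _ _ _
  (fun i x => partial i u x * v x + u x * partial i v x)) => //.
- by move=> x Ux; apply: (continuousM (Ck_cont hu Ux) (Ck_cont hv Ux)).
- by move=> i x Ux; apply: is_derive_mul; apply: CkS_is_derive Ux; eassumption.
- by move=> i; apply: CkD => //; apply: IH; try exact: CkS_partial; exact: CkS.
Qed.

Lemma CkV k U u : open U -> (forall x, U x -> u x != 0) -> Ck_on k U u ->
  Ck_on k U (fun x => (u x)^-1).
Proof.
move=> oU u0; elim: k => [|k IH] hu.
  by split=> // x Ux; apply: (continuousV (u0 x Ux) (Ck_cont hu Ux)).
apply: (@CkS_intro _ _ _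
  (fun i x => -1 * ((u x)^-1 * (u x)^-1) * partial i u x)) => //.
- by move=> x Ux; apply: (continuousV (u0 x Ux) (Ck_cont hu Ux)).
- move=> i x Ux; have := is_deriveV (u0 x Ux) (CkS_is_derive i hu Ux).
  by rewrite mulN1r expr2 invfM.
- have hV := IH (CkS hu).
  move=> i; apply: CkM => //; last exact: CkS_partial.
  by do !apply: CkM => //; exact: Ck_cst.
Qed.

Lemma Ck_expR k U u : open U -> Ck_on k U u -> Ck_on k U (fun x => expR (u x)).
Proof.
move=> oU; have cE x : U x -> {for x, continuous u} ->
    {for x, continuous (fun x => expR (u x))}.
  by move=> Ux cu; apply: continuous_comp => //; exact: continuous_expR.
elim: k => [|k IH] hu.
  by split=> // x Ux; apply: cE => //; exact: (Ck_cont hu Ux).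
apply: (@CkS_intro _ _ _ (fun i x => partial i u x * expR (u x))) => //.
- by move=> x Ux; apply: cE => //; exact: (Ck_cont hu Ux).
- move=> i x Ux; apply: is_derive_expR_comp; exact: CkS_is_derive hu Ux.
- by move=> i; apply: CkM => //; [exact: CkS_partial|apply: IH; exact: CkS].
Qed.

Lemma smooth_open_eq U u v : open U -> (forall y, U y -> u y = v y) ->
  smooth_on U u -> smooth_on U v.
Proof. by move=> oU uv hu k; exact: Ck_open_eq uv (hu k). Qed.

Lemma smooth_cst U (c : R) : open U -> smooth_on U (fun=> c).
Proof. by move=> oU k; exact: Ck_cst. Qed.

Lemma smoothD U u v : open U -> smooth_on U u -> smooth_on U v ->
  smooth_on U (fun x => u x + v x).
Proof. by move=> oU hu hv k; exact: CkD. Qed.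

Lemma smoothM U u v : open U -> smooth_on U u -> smooth_on U v ->
  smooth_on U (fun x => u x * v x).
Proof. by move=> oU hu hv k; exact: CkM. Qed.

Lemma smoothN U u : open U -> smooth_on U u -> smooth_on U (fun x => - u x).
Proof.
move=> oU hu; apply: (@smooth_open_eq _ (fun x => -1 * u x)) => //.
  by move=> y _; rewrite mulN1r.
by apply: smoothM => //; exact: smooth_cst.
Qed.

Lemma smoothV U u : open U -> (forall x, U x -> u x != 0) -> smooth_on U u ->
  smooth_on U (fun x => (u x)^-1).
Proof. by move=> oU u0 hu k; exact: CkV. Qed.

Lemma smooth_expR U u : open U -> smooth_on U u ->
  smooth_on U (fun x => expR (u x)).
Proof. by move=> oU hu k; exact: Ck_expR. Qed.

Lemma smooth_sum U (I : Type) (s : seq I) (P : pred I) (u : I -> 'rV[R]_n -> R) :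
  open U -> (forall i, smooth_on U (u i)) ->
  smooth_on U (fun x => \sum_(i <- s | P i) u i x).
Proof.
move=> oU hu; elim: s => [|i s IH].
  by apply: (@smooth_open_eq _ (fun=> 0)) (smooth_cst _ _) => // y; rewrite big_nil.
case Pi : (P i).
  apply: (@smooth_open_eq _ (fun x => u i x + \sum_(i <- s | P i) u i x)).
  - by [].
  - by move=> y _; rewrite big_cons Pi.
  - exact: smoothD.
by apply: smooth_open_eq IH => // y _; rewrite big_cons Pi.
Qed.

Lemma smooth_prod U (I : Type) (s : seq I) (u : I -> 'rV[R]_n -> R) :
  open U -> (forall i, smooth_on U (u i)) ->
  smooth_on U (fun x => \prod_(i <- s) u i x).
Proof.
move=> oU hu; elim: s => [|i s IH].
  by apply: (@smooth_open_eq _ (fun=> 1)) (smooth_cst _ _) => // y; rewrite big_nil.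
apply: (@smooth_open_eq _ (fun x => u i x * \prod_(i <- s) u i x)).
- by [].
- by move=> y _; rewrite big_cons.
- exact: smoothM.
Qed.

Lemma smooth_is_derive U u i x : smooth_on U u -> U x ->
  is_derive x (delta_mx 0 i) u (partial i u x).
Proof. by move=> hu; exact: CkS_is_derive (hu 1). Qed.

Lemma smooth_partial U u i : smooth_on U u -> smooth_on U (partial i u).
Proof. by move=> hu k; exact: CkS_partial (hu k.+1). Qed.

Lemma is_derive_linear (l : 'rV[R]_n -> R) (x v : 'rV[R]_n) : linear l ->
  is_derive x v l (l v).
Proof.
move=> hl; exact: (@is_derive_comp_linear _ _ _ l id).
Qed.

Lemma smooth_coord U i : open U -> smooth_on U (fun x => x 0 i).
Proof.
move=> oU [|k]; first by split=> // x _; exact: coord_continuous.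
apply: (@CkS_intro _ _ _ (fun j _ => delta_mx 0 j 0 i)) => //.
- by move=> x _; exact: coord_continuous.
- move=> j x _; apply: (@is_derive_linear (fun x : 'rV[R]_n => x 0 i)).
  by move=> a y z; rewrite !mxE.
- by move=> j; exact: Ck_cst.
Qed.

Definition lin_form (a x : 'rV[R]_n) : R := \sum_i a 0 i * x 0 i.

Lemma lin_form_linear a : linear (lin_form a).
Proof.
move=> c x y; rewrite /lin_form scaler_sumr -big_split /=.
by apply: eq_bigr => i _; rewrite !mxE mulrDr mulrCA.
Qed.

Lemma lin_form_delta a i : lin_form a (delta_mx 0 i) = a 0 i.
Proof.
rewrite /lin_form (bigD1 i) //= big1 => [|j ji]; rewrite !mxE ?eqxx.
  by rewrite mulr1 addr0.
by rewrite (negbTE ji) mulr0.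
Qed.

Lemma smooth_lin_form U a : open U -> smooth_on U (lin_form a).
Proof.
move=> oU; apply: smooth_sum => // i; apply: smoothM => //.
  exact: smooth_cst.
exact: smooth_coord.
Qed.

Lemma is_derive_radial (u : R -> R) (a x : 'rV[R]_n) i (du : R) :
  is_derive (lin_form a x) 1 u du ->
  is_derive x (delta_mx 0 i) (fun y => u (lin_form a y)) (a 0 i * du).
Proof.
move=> hu; apply: (is_derive_comp_linear (lin_form_linear a)).
by rewrite lin_form_delta; exact: is_derive1_dir.
Qed.

Lemma smooth_det U (p : nat) (M : 'rV[R]_n -> 'M[R]_p) : open U ->
  (forall i j, smooth_on U (fun x => M x i j)) ->
  smooth_on U (fun x => \det (M x)).
Proof.
move=> oU hM; apply: smooth_sum => // s; apply: smoothM => //.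
  exact: smooth_cst.
exact: smooth_prod.
Qed.

(** By Cramer's rule. *)
Lemma smooth_invmx U (p : nat) (M : 'rV[R]_n -> 'M[R]_p) : open U ->
  (forall x, U x -> M x \in unitmx) ->
  (forall i j, smooth_on U (fun x => M x i j)) ->
  forall i j, smooth_on U (fun x => invmx (M x) i j).
Proof.
move=> oU uM hM i j.
apply: (@smooth_open_eq _ (fun x => (\det (M x))^-1 * cofactor (M x) j i)) => //.
  by move=> y /uM My; rewrite /invmx My !mxE.
apply: smoothM => //.
  apply: smoothV => //; last exact: smooth_det.
  by move=> x /uM; rewrite unitmxE unitfE.
apply: smoothM => //; first exact: smooth_cst.
apply: smooth_det => // a b.
apply: (@smooth_open_eq _ (fun x => M x (lift j a) (lift i b))) => //.
by move=> y _; rewrite !mxE.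
Qed.

Lemma smooth_christoffel U g k i j : open U ->
  (forall x, U x -> g x \in unitmx) ->
  (forall i j, smooth_on U (fun x => g x i j)) ->
  smooth_on U (christoffel g k i j).
Proof.
move=> oU ug hg; apply: smoothM => //; first exact: smooth_cst.
apply: smooth_sum => // l; apply: smoothM => //; first exact: smooth_invmx.
by apply: smoothD => //; [apply: smoothD => //|apply: smoothN => //];
  apply: smooth_partial.
Qed.

End SmoothFunctions.

(** * Functions of one group of coordinates *)

Section Projections.
Variables (R : realType) (n m : nat).
Implicit Types (u : 'rV[R]_m -> R) (w : 'rV[R]_n -> R) (z : 'rV[R]_(n + m)).

Lemma lsubmx_delta_lshift (i : 'I_n) :
  lsubmx (delta_mx 0 (lshift m i) : 'rV[R]_(n + m)) = delta_mx 0 i.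
Proof. by apply/rowP => j; rewrite !mxE eq_lshift. Qed.

Lemma lsubmx_delta_rshift (i : 'I_m) :
  lsubmx (delta_mx 0 (rshift n i) : 'rV[R]_(n + m)) = 0.
Proof. by apply/rowP => j; rewrite !mxE eq_lrshift. Qed.

Lemma rsubmx_delta_lshift (i : 'I_n) :
  rsubmx (delta_mx 0 (lshift m i) : 'rV[R]_(n + m)) = 0.
Proof. by apply/rowP => j; rewrite !mxE eq_rlshift. Qed.

Lemma rsubmx_delta_rshift (i : 'I_m) :
  rsubmx (delta_mx 0 (rshift n i) : 'rV[R]_(n + m)) = delta_mx 0 i.
Proof. by apply/rowP => j; rewrite !mxE eq_rshift. Qed.

Lemma linear_lsubmx : linear (lsubmx : 'rV[R]_(n + m) -> 'rV[R]_n).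
Proof. by move=> c x y; apply/rowP => i; rewrite !mxE. Qed.

Lemma linear_rsubmx : linear (rsubmx : 'rV[R]_(n + m) -> 'rV[R]_m).
Proof. by move=> c x y; apply/rowP => i; rewrite !mxE. Qed.

Lemma partial_rsubmx_lshift u i z : partial (lshift m i) (u \o rsubmx) z = 0.
Proof.
rewrite /partial (derive_comp_linear _ _ _ linear_rsubmx).1.
by rewrite rsubmx_delta_lshift derive0.
Qed.

Lemma partial_rsubmx_rshift u i z :
  partial (rshift n i) (u \o rsubmx) z = partial i u (rsubmx z).
Proof.
by rewrite /partial (derive_comp_linear _ _ _ linear_rsubmx).1 rsubmx_delta_rshift.
Qed.

Lemma partial_lsubmx_lshift w i z :
  partial (lshift m i) (w \o lsubmx) z = partial i w (lsubmx z).
Proof.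
by rewrite /partial (derive_comp_linear _ _ _ linear_lsubmx).1 lsubmx_delta_lshift.
Qed.

Lemma partial_lsubmx_rshift w i z : partial (rshift n i) (w \o lsubmx) z = 0.
Proof.
rewrite /partial (derive_comp_linear _ _ _ linear_lsubmx).1.
by rewrite lsubmx_delta_rshift derive0.
Qed.

(** A linear map sending each basis vector to a basis vector or to 0 turns
    partial derivatives into partial derivatives, so that the chain rule holds
    without total differentiability. *)
Lemma smooth_comp_proj N p (l : 'rV[R]_N -> 'rV[R]_p)
    (U : set 'rV[R]_N) (V : set 'rV[R]_p) (f : 'rV[R]_p -> R) :
  continuous l -> linear l ->
  (forall i, l (delta_mx 0 i) = 0 \/ exists j, l (delta_mx 0 i) = delta_mx 0 j) ->
  open U -> (forall y, U y -> V (l y)) -> smooth_on V f -> smooth_on U (f \o l).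
Proof.
move=> cl hl le oU UV hf k; elim: k f {hf}(hf k) => [|k IH] f hf.
  split=> // y Uy; apply: continuous_comp; first exact: cl.
  exact: Ck_cont hf (UV y Uy).
split=> [y Uy|i].
  apply: continuous_comp; first exact: cl.
  exact: Ck_cont hf (UV y Uy).
split=> [y Uy|].
  apply: (derive_comp_linear _ _ _ hl).2.
  have [->|[j ->]] := le i; first exact: derivable0.
  by case: hf => _ /(_ j)[d _]; apply: d; exact: UV.
have [l0|[j lj]] := le i.
  rewrite (_ : partial _ _ = fun=> 0); first exact: Ck_cst.
  apply/funext => y; rewrite /partial (derive_comp_linear _ _ _ hl).1 l0.
  exact: derive0.
rewrite (_ : partial _ _ = partial j f \o l).
  by apply: IH; case: hf => _ /(_ j)[].
by apply/funext => y; rewrite /partial (derive_comp_linear _ _ _ hl).1 lj.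
Qed.

Lemma smooth_rsubmx (U : set 'rV[R]_(n + m)) (V : set 'rV[R]_m) u :
  open U -> (forall z, U z -> V (rsubmx z)) -> smooth_on V u ->
  smooth_on U (u \o rsubmx).
Proof.
apply: smooth_comp_proj; [exact: continuous_rsubmx|exact: linear_rsubmx|move=> i].
case: (split_ordP i) => j ->; last by right; exists j; exact: rsubmx_delta_rshift.
by left; exact: rsubmx_delta_lshift.
Qed.

Lemma smooth_lsubmx (U : set 'rV[R]_(n + m)) (V : set 'rV[R]_n) w :
  open U -> (forall z, U z -> V (lsubmx z)) -> smooth_on V w ->
  smooth_on U (w \o lsubmx).
Proof.
apply: smooth_comp_proj; [exact: continuous_lsubmx|exact: linear_lsubmx|move=> i].
case: (split_ordP i) => j ->; first by right; exists j; exact: lsubmx_delta_lshift.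
by left; exact: lsubmx_delta_rshift.
Qed.

End Projections.


(** * Product topology and row vectors *)

Section ProductTopology.
Variables S T : topologicalType.

Lemma open_setX (A : set S) (B : set T) : open A -> open B -> open (A `*` B).
Proof.
rewrite !openE => oA oB [x y] [/= Ax By]; exists (A, B) => //=.
by split; [exact: oA|exact: oB].
Qed.

Lemma nbhs_setX (x : S) (y : T) A B : nbhs x A -> nbhs y B ->
  nbhs (x, y) (A `*` B).
Proof. by move=> xA yB; exists (A, B). Qed.

Lemma hausdorff_prod : hausdorff_space S -> hausdorff_space T ->
  hausdorff_space (S * T)%type.
Proof.
move=> hS hT [p1 p2] [q1 q2] cl; congr (_, _).
- apply: hS => A B pA qB.
  have [[x y] [/= [Ax _] [Bx _]]] := cl _ _
    (nbhs_setX pA (filterT : nbhs p2 setT)) (nbhs_setX qB (filterT : nbhs q2 setT)).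
  by exists x.
apply: hT => A B pA qB.
have [[x y] [/= [_ Ay] [_ By]]] := cl _ _
  (nbhs_setX (filterT : nbhs p1 setT) pA) (nbhs_setX (filterT : nbhs q1 setT) qB).
by exists y.
Qed.

Lemma second_countable_prod : @second_countable S -> @second_countable T ->
  @second_countable (S * T)%type.
Proof.
move=> [A cA [oA bA]] [B cB [oB bB]].
exists ((fun p : set S * set T => p.1 `*` p.2) @` (A `*` B)).
  by apply: (sub_countable (card_image_le _ _)); exact: countableX.
split=> [_ [[X Y] [/= AX BY] <-]|[x y] V [[P Q] [/= xP yQ] sV]].
  by apply: open_setX; [exact: oA|exact: oB].
have [X [AX Xx] XP] := bA x _ xP; have [Y [BY Yy] YQ] := bB y _ yQ.
exists (X `*` Y); first by split => //; exists (X, Y).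
by move=> [s t] [/= Xs Yt]; apply: sV; split; [exact: XP|exact: YQ].
Qed.

Lemma continuous_pair (P : topologicalType) (u : P -> S) (v : P -> T) t :
  {for t, continuous u} -> {for t, continuous v} ->
  {for t, continuous (fun s => (u s, v s))}.
Proof.
move=> cu cv A [[X Y] [/= uX vY] XYA].
have cuv : nbhs t (u @^-1` X `&` v @^-1` Y).
  by apply: filterI; [exact: cu|exact: cv].
change (nbhs t ((fun s => (u s, v s)) @^-1` A)).
by apply: filterS cuv => s [Xu Yv]; exact: XYA.
Qed.

End ProductTopology.

Section RowVectors.
Variables (R : realType).

(** Interiors of balls of radius 1 / (k + 1) about rational points form a
    countable base. *)
Lemma second_countable_rV n : @second_countable 'rV[R]_n.
Proof.
pose b (p : 'rV[rat]_n * nat) : set 'rV[R]_n :=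
  (ball (map_mx (@ratr R) p.1) p.2.+1%:R^-1)°.
exists (b @` setT).
  by apply: (sub_countable (card_image_le _ _)); exact: countableP.
split=> [_ [p _ <-]|x V]; first exact: open_interior.
move=> /nbhs_ballP[e /= e0 eV].
have [k ke] : exists k, k.+1%:R^-1 < e / 2 :> R.
  have e20 : 0 < e / 2 by rewrite divr_gt0.
  have [k] := @ltr_add_invr R 0 (e / 2) e20.
  by rewrite add0r => ke; exists k.
have k0 : 0 < k.+1%:R^-1 :> R by rewrite invr_gt0.
set d : R := k.+1%:R^-1 in ke k0 *.
have rat_near i : exists q : rat, `|x 0 i - ratr q| < d / 2.
  have /rat_in_itvoo[q] : x 0 i - d / 2 < x 0 i + d / 2 by lra.
  by rewrite in_itv /= => /andP[q1 q2]; exists q;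
    rewrite ltr_norml; apply/andP; split; lra.
pose q : 'rV[rat]_n := \row_i projT1 (cid (rat_near i)).
have qx : ball (map_mx (@ratr R) q) (d / 2) x.
  split=> [|i j]; first by rewrite divr_gt0.
  rewrite !mxE ord1 /ball /= distrC; exact: (projT2 (cid (rat_near j))).
exists (b (q, k)).
  split; first by exists (q, k).
  rewrite /b /interior /=; apply/nbhs_ballP; exists (d / 2) => /=.
    by rewrite divr_gt0.
  move=> y xy; rewrite -/d [d]splitr; exact: ball_triangle qx xy.
move=> y /interior_subset by_; apply: eV; rewrite [e]splitr.
apply: (@ball_triangle _ _ (map_mx (@ratr R) q)).
  by apply/ball_sym/(le_ball _ qx); lra.
by apply: le_ball by_; exact: ltW.
Qed.

Lemma continuous_row_mx (T : topologicalType) n m (u : T -> 'rV[R]_n)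
    (v : T -> 'rV[R]_m) t : {for t, continuous u} -> {for t, continuous v} ->
  {for t, continuous (fun s => row_mx (u s) (v s))}.
Proof.
move=> cu cv A /nbhs_ballP[e /= e0 eA].
have /cu cu' : nbhs (u t) (ball (u t) e) by exact: nbhsx_ballx.
have /cv cv' : nbhs (v t) (ball (v t) e) by exact: nbhsx_ballx.
have cuv : nbhs t (u @^-1` ball (u t) e `&` v @^-1` ball (v t) e).
  exact: filterI.
change (nbhs t ((fun s => row_mx (u s) (v s)) @^-1` A)).
apply: filterS cuv => s [[_ us] [_ vs]]; apply: eA; split=> // i j.
by rewrite !mxE; case: splitP => k _; [exact: us|exact: vs].
Qed.

End RowVectors.

(** * Conformal change of Christoffel symbols: the algebra at a point *)

(** Throughout, L stands for the Christoffel symbols at a point of a metric h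
    for which the covector a is parallel of norm 1; both contractions of L with
    a then vanish. *)
Section ConformalAlgebra.
Variables (R : realType) (N : nat) (a : 'rV[R]_N) (h : 'M[R]_N).
Variable L : 'I_N -> 'I_N -> 'I_N -> R.
Hypothesis hsym : h^T = h.
Hypothesis ah : a *m h = a.
Hypothesis aa : lin_form a a = 1.
Hypothesis Lsym : forall k i j, L k i j = L k j i.
Hypothesis aL_up : forall i j, \sum_k a 0 k * L k i j = 0.
Hypothesis aL_down : forall k i, \sum_j a 0 j * L k i j = 0.

(** The Christoffel symbols of exp (2 xi) h, where d xi = a is its own metric
    dual. *)
Definition conformal_christoffel k i j : R :=
  L k i j + (k == i)%:R * a 0 j + (k == j)%:R * a 0 i - h i j * a 0 k.
Local Notation G := conformal_christoffel.

Lemma sum_delta (F : 'I_N -> R) j : \sum_i (i == j)%:R * F i = F j.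
Proof.
rewrite (bigD1 j) //= eqxx mul1r big1 ?addr0 // => i /negbTE ->.
by rewrite mul0r.
Qed.

Let hC i j : h i j = h j i.
Proof. by rewrite -[in LHS]hsym mxE. Qed.

Let ahE j : \sum_i a 0 i * h i j = a 0 j.
Proof. by rewrite -[in RHS]ah mxE. Qed.

Let haE j : \sum_i h j i * a 0 i = a 0 j.
Proof.
rewrite -[RHS]ahE; apply: eq_bigr => i _.
by rewrite mulrC hC.
Qed.

Lemma conformal_christoffel_trace p :
  \sum_i G i i p = \sum_i L i i p + N%:R * a 0 p.
Proof.
rewrite sumrB !big_split /= sum_delta.
have -> : \sum_(i < N) (i == i)%:R * a 0 p = \sum_(i < N) a 0 p.
  by apply: eq_bigr => i _; rewrite eqxx mul1r.
rewrite sumr_const card_ord mulr_natl.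
under [X in _ - X]eq_bigr do rewrite mulrC.
by rewrite ahE addrK.
Qed.

Lemma conformal_quadratic1 j k :
  \sum_i \sum_p G i i p * G p j k
  = \sum_i \sum_p L i i p * L p j k
    + a 0 j * (\sum_i L i i k) + a 0 k * (\sum_i L i i j)
    + 2 * N%:R * a 0 j * a 0 k - N%:R * h j k.
Proof.
rewrite exchange_big [X in _ = X + _ + _ + _ - _]exchange_big /=.
under eq_bigr do rewrite -mulr_suml conformal_christoffel_trace.
under [in RHS]eq_bigr do rewrite -mulr_suml.
set t := fun p => \sum_i L i i p.
have ta : \sum_p a 0 p * t p = 0.
  rewrite /t; under eq_bigr do rewrite mulr_sumr.
  by rewrite exchange_big big1 //= => i _; rewrite aL_down.
transitivity (\sum_p (t p * L p j k + N%:R * (a 0 p * L p j k)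
   + (p == j)%:R * ((t p + N%:R * a 0 p) * a 0 k)
   + (p == k)%:R * ((t p + N%:R * a 0 p) * a 0 j)
   - h j k * (a 0 p * t p) - h j k * N%:R * (a 0 p * a 0 p))).
  by apply: eq_bigr => p _; rewrite /G -/(t p); ring.
rewrite !sumrB !big_split /= !sum_delta -!mulr_sumr aL_up ta.
rewrite -/(lin_form a a) aa -/(t j) -/(t k); ring.
Qed.

Lemma conformal_quadratic2 j k :
  \sum_i \sum_p G i j p * G p i k
  = \sum_i \sum_p L i j p * L p i k
    + a 0 j * (\sum_i L i i k) + a 0 k * (\sum_i L i i j)
    + (N%:R + 2) * a 0 j * a 0 k - 2 * h j k.
Proof.
have inner_sum i : \sum_p G i j p * G p i k =
    \sum_p L i j p * L p i k + L i i j * a 0 k + L i j k * a 0 i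
    + L i i k * a 0 j + a 0 j * a 0 k
    + (i == j)%:R * (2 * a 0 i * a 0 k - h i k)
    + (i == k)%:R * (a 0 j * a 0 i)
    - (\sum_p h j p * L p i k) * a 0 i - (a 0 i * h i j) * a 0 k
    - h j k * (a 0 i * a 0 i) + a 0 j * (a 0 i * h i k)
    - a 0 j * (h i k * a 0 i) .
  transitivity (\sum_p (L i j p * L p i k
     + (p == i)%:R * (L i j p * a 0 k) + (p == k)%:R * (L i j p * a 0 i)
     - h i k * (a 0 p * L i j p)
     + (i == j)%:R * (a 0 p * L p i k) + (p == i)%:R * ((i == j)%:R * a 0 p * a 0 k)
     + (p == k)%:R * ((i == j)%:R * a 0 p * a 0 i)
     - (i == j)%:R * h i k * (a 0 p * a 0 p)
     + (p == i)%:R * (L p i k * a 0 j) + (p == i)%:R * (a 0 j * a 0 k)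
     + (p == k)%:R * ((i == p)%:R * a 0 j * a 0 i) 
     - (p == i)%:R * (a 0 j * h i k * a 0 p)
     - h j p * L p i k * a 0 i
     - (p == i)%:R * (h j p * a 0 i * a 0 k) - (p == k)%:R * (h j p * a 0 i * a 0 i)
     + (h j p * a 0 p) * (a 0 i * h i k))).
    apply: eq_bigr => p _; rewrite /G [i == p]eq_sym.
    have [->|_] := eqVneq p i; 
      [have [->|_] := eqVneq i k | have [->|_] := eqVneq p k] => /=;
      rewrite ?mul1r ?mul0r; ring.
  rewrite !(sumrB, big_split) /= !sum_delta -!mulr_sumr -!mulr_suml.
  rewrite aL_up aL_down haE -/(lin_form a a) aa.
  rewrite [L i j i]Lsym [h j i]hC; ring.
under eq_bigr do rewrite inner_sum.
rewrite !(sumrB, big_split) /= !sum_delta -!mulr_sumr -!mulr_suml.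
rewrite sumr_const card_ord.
have -> : \sum_i L i j k * a 0 i = 0.
  by under eq_bigr do rewrite mulrC; exact: aL_up.
have -> : \sum_i (\sum_p h j p * L p i k) * a 0 i = 0.
  under eq_bigr do rewrite mulr_suml.
  rewrite exchange_big big1 //= => p _.
  under eq_bigr do rewrite -mulrA [L _ _ _ * _]mulrC [L _ _ k]Lsym.
  by rewrite -mulr_sumr aL_down mulr0.
rewrite !ahE -/(lin_form a a) aa.
under [X in _ - _ * X]eq_bigr do rewrite mulrC.
rewrite ahE -mulr_natl; ring.
Qed.

(** The terms mixing L and a cancel between the two halves, so the quadratic
    part of the Ricci tensor changes by a multiple of a tensor a - h alone. *)
Lemma conformal_quadratic j k :
  \sum_i \sum_p (G i i p * G p j k - G i j p * G p i k)
  = \sum_i \sum_p (L i i p * L p j k - L i j p * L p i k)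
    + (N%:R - 2) * (a 0 j * a 0 k - h j k).
Proof.
under eq_bigr do rewrite sumrB.
under [in RHS]eq_bigr do rewrite sumrB.
rewrite !sumrB conformal_quadratic1 conformal_quadratic2; ring.
Qed.

End ConformalAlgebra.

(** * Conformal change by the exponential of a parallel linear form *)

Local Opaque partial.

(** The constant covector a is parallel of norm 1 for the metric h on U.
    Equivalently, h is locally the product of the Euclidean line in the direction
    a with a metric on the Euclidean complement of a: by [up_fix] the vector a is
    the metric dual of the covector a, and by [up_invariant] h does not change
    along it. *)
Record unit_parallel (R : realType) (N : nat) (U : set 'rV[R]_N)
    (a : 'rV[R]_N) (h : 'rV[R]_N -> 'M[R]_N) : Prop := UnitParallel {
  up_open : open U;
  up_sym : forall x, U x -> (h x)^T = h x;
  up_unit : forall x, U x -> h x \in unitmx;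
  up_smooth : forall i j, smooth_on U (fun x => h x i j);
  up_fix : forall x, U x -> a *m h x = a;
  up_invariant : forall x i j, U x ->
    \sum_k a 0 k * partial k (fun y => h y i j) x = 0;
  up_norm : lin_form a a = 1 }.

Section ConformalMetric.
Variables (R : realType) (N : nat) (U : set 'rV[R]_N).
Variables (a : 'rV[R]_N) (h : 'rV[R]_N -> 'M[R]_N).
Hypothesis parallel_a : unit_parallel U a h.

Let oU := up_open parallel_a.
Let hsym := up_sym parallel_a.
Let hunit := up_unit parallel_a.
Let hsmooth := up_smooth parallel_a.
Let ah := up_fix parallel_a.
Let dah := up_invariant parallel_a.
Let aa := up_norm parallel_a.

Definition exp_conformal x := expR (2 * lin_form a x) *: h x.
Local Notation G := exp_conformal.

Let hC x i j : U x -> h x i j = h x j i.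
Proof. by move=> Ux; rewrite -[in LHS](hsym Ux) mxE. Qed.

Let dhC x i j k : U x ->
  partial k (fun y => h y i j) x = partial k (fun y => h y j i) x.
Proof. by move=> Ux; apply: (partial_open_eq _ oU) => // y; exact: hC. Qed.

Let adh x i j : U x -> \sum_l a 0 l * partial i (fun y => h y j l) x = 0.
Proof.
move=> Ux.
have E y : U y -> \sum_l h y j l * a 0 l = a 0 j.
  move=> Uy; rewrite -[in RHS](ah Uy) mxE; apply: eq_bigr => l _.
  by rewrite mulrC hC.
transitivity (partial i (fun y => \sum_l h y j l * a 0 l) x); last first.
  rewrite (partial_open_eq i oU E Ux).
  exact: partialE (is_derive_const (a 0 j) x (delta_mx 0 i)).
apply/esym/partialE.
apply: (@is_derive_bigsum _ _ 'I_N (fun l y => h y j l * a 0 l) _ _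
  (fun l => a 0 l * partial i (fun y => h y j l) x)) => l.
apply: is_derive_eq (is_derive_mul (smooth_is_derive _ _ Ux)
  (is_derive_const (a 0 l) _ _)) _ => //.
by rewrite mulr0 addr0 mulrC.
Qed.

Lemma parallel_christoffel_up x i j : U x ->
  \sum_k a 0 k * christoffel h k i j x = 0.
Proof.
move=> Ux; rewrite /christoffel.
under eq_bigr do rewrite mulrCA mulr_sumr.
rewrite -mulr_sumr exchange_big /=.
have ainv l : \sum_k a 0 k * invmx (h x) k l = a 0 l.
  by rewrite -[in RHS](mulmxK (hunit Ux) a) ah // mxE.
under eq_bigr do under eq_bigr do rewrite mulrA.
under eq_bigr do rewrite -mulr_suml ainv mulrBr mulrDr.
rewrite sumrB big_split /= (adh i j Ux) (adh j i Ux) (dah i j Ux).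
by rewrite !addr0 subr0 mulr0.
Qed.

Lemma parallel_christoffel_down x k i : U x ->
  \sum_j a 0 j * christoffel h k i j x = 0.
Proof.
move=> Ux; rewrite /christoffel.
under eq_bigr do rewrite mulrCA mulr_sumr.
rewrite -mulr_sumr exchange_big /= big1 ?mulr0 // => l _.
under eq_bigr do rewrite mulrCA.
rewrite -mulr_sumr; under eq_bigr do rewrite mulrBr mulrDr (dhC _ _ _ Ux).
rewrite sumrB big_split /= (adh i l Ux) (dah i l Ux) (adh l i Ux).
by rewrite !addr0 subr0 mulr0.
Qed.

Lemma christoffelC x k i j : U x -> christoffel h k i j x = christoffel h k j i x.
Proof.
move=> Ux; congr (_ * _); apply: eq_bigr => l _.
by rewrite (dhC _ _ _ Ux) [X in _ * (X - _)]addrC; congr (_ * (_ - _)); rewrite dhC.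
Qed.

Lemma is_derive_exp_weight x i :
  is_derive x (delta_mx 0 i) (fun y => expR (2 * lin_form a y))
    (2 * a 0 i * expR (2 * lin_form a x)).
Proof.
apply: is_derive_expR_comp.
apply: is_derive_eq (is_derive_mul (is_derive_const _ _ _)
  (is_derive_linear _ _ (lin_form_linear a))) _.
by rewrite mul0r add0r lin_form_delta.
Qed.

Lemma is_derive_exp_conformal x i j k : U x ->
  is_derive x (delta_mx 0 k) (fun y => G y i j)
    (expR (2 * lin_form a x) *
      (2 * a 0 k * h x i j + partial k (fun y => h y i j) x)).
Proof.
move=> Ux; have -> : (fun y => G y i j) =
    (fun y => expR (2 * lin_form a y) * h y i j).
  by apply/funext => y; rewrite mxE.
apply: is_derive_eq (is_derive_mul (is_derive_exp_weight _ _)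
  (smooth_is_derive _ (hsmooth i j) Ux)) _.
by ring.
Qed.

Lemma exp_conformal_unit x : U x -> G x \in unitmx.
Proof.
by move=> Ux; rewrite unitmxZ ?hunit // unitfE gt_eqF // expR_gt0.
Qed.

Lemma invmx_exp_conformal x : U x ->
  invmx (G x) = expR (- 2 * lin_form a x) *: invmx (h x).
Proof.
move=> Ux; rewrite invmxZ ?exp_conformal_unit //.
by rewrite mulNr expRN.
Qed.

Lemma christoffel_exp_conformal x k i j : U x ->
  christoffel G k i j x
  = conformal_christoffel a (h x) (fun k i j => christoffel h k i j x) k i j.
Proof.
move=> Ux; rewrite /conformal_christoffel /christoffel invmx_exp_conformal //.
have inv_h l m : \sum_p invmx (h x) l p * h x m p = (l == m)%:R.
  have := mulVmx (hunit Ux) => /matrixP/(_ l m); rewrite !mxE => <-.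
  by apply: eq_bigr => p _; rewrite hC.
have inv_a : \sum_p invmx (h x) k p * a 0 p = a 0 k.
  have E : invmx (h x) *m a^T = a^T.
    by rewrite -[in LHS](ah Ux) trmx_mul hsym // mulKmx // hunit.
  have /matrixP/(_ k 0) := E; rewrite !mxE => <-.
  by apply: eq_bigr => p _; rewrite mxE.
transitivity (2^-1 * \sum_l (invmx (h x) k l *
     (partial i (fun y => h y j l) x + partial j (fun y => h y i l) x
      - partial l (fun y => h y i j) x)
   + 2 * a 0 i * (invmx (h x) k l * h x j l)
   + 2 * a 0 j * (invmx (h x) k l * h x i l)
   - 2 * h x i j * (invmx (h x) k l * a 0 l))).
  congr (_ * _); apply: eq_bigr => l _; rewrite mxE.
  rewrite !(partialE (is_derive_exp_conformal _ _ _ Ux)).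
  rewrite mulNr expRN; field.
  by rewrite gt_eqF // expR_gt0.
rewrite sumrB !big_split /= -!mulr_sumr !inv_h inv_a.
by field.
Qed.

Lemma is_derive_christoffel_exp_conformal x k i j l : U x ->
  is_derive x (delta_mx 0 l) (christoffel G k i j)
    (partial l (christoffel h k i j) x
     - partial l (fun y => h y i j) x * a 0 k).
Proof.
move=> Ux; apply: (@is_derive_open_eq _ _ U (fun y =>
   conformal_christoffel a (h y) (fun k i j => christoffel h k i j y) k i j)) => //.
  by move=> y Uy; rewrite christoffel_exp_conformal.
rewrite /conformal_christoffel.
have dL := smooth_is_derive l (smooth_christoffel k i j oU hunit hsmooth) Ux.
have cst c := is_derive_const c x (delta_mx 0 l : 'rV[R]_N).
have dh := is_derive_mul (smooth_is_derive l (hsmooth i j) Ux) (cst (a 0 k)).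
have dT := is_derive_add (is_derive_add dL (cst ((k == i)%:R * a 0 j)))
             (cst ((k == j)%:R * a 0 i)).
apply: is_derive_eq (is_derive_add dT (is_derive_opp dh)) _.
by rewrite mulr0 !addr0.
Qed.

(** The classical formula for a conformal change by xi has the further terms
    (N - 2) Hess xi and (Laplacian of xi) h; both vanish here because d xi = a is
    parallel. *)
Lemma ricci_exp_conformal x : U x ->
  ricci G x = ricci h x + (N%:R - 2) *: (a^T *m a - h x).
Proof.
move=> Ux; apply/matrixP => j k; rewrite !mxE big_ord1 !mxE.
pose L k i j := christoffel h k i j x.
have quad := @conformal_quadratic R N a (h x) L (hsym Ux) (ah Ux) aa
  (fun k i j => christoffelC k i j Ux) (fun i j => parallel_christoffel_up i j Ux)
  (fun k i => parallel_christoffel_down k i Ux) j k.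
have diff : \sum_i (partial i (christoffel h i j k) x
      - partial i (fun y => h y j k) x * a 0 i
      - (partial j (christoffel h i i k) x - partial j (fun y => h y i k) x * a 0 i))
    = \sum_i (partial i (christoffel h i j k) x - partial j (christoffel h i i k) x).
  transitivity (\sum_i (partial i (christoffel h i j k) x
      - partial j (christoffel h i i k) x
      - a 0 i * partial i (fun y => h y j k) x
      + a 0 i * partial j (fun y => h y k i) x)).
    have alg (p q r s c : R) : p - r * c - (q - s * c) = p - q - c * r + c * s.
      by ring.
    by apply: eq_bigr => i _; rewrite (@dhC _ i k j Ux) alg.
  by rewrite big_split sumrB /= (dah _ _ Ux) (adh _ _ Ux) subr0 addr0.
transitivity (\sum_i (partial i (christoffel h i j k) x
      - partial i (fun y => h y j k) x * a 0 i
      - (partial j (christoffel h i i k) x - partial j (fun y => h y i k) x * a 0 i))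
   + \sum_i \sum_p (conformal_christoffel a (h x) L i i p
          * conformal_christoffel a (h x) L p j k
        - conformal_christoffel a (h x) L i j p
          * conformal_christoffel a (h x) L p i k)).
  rewrite -big_split; apply: eq_bigr => i _; congr (_ - _ + _).
  - exact: partialE (is_derive_christoffel_exp_conformal _ _ _ _ Ux).
  - exact: partialE (is_derive_christoffel_exp_conformal _ _ _ _ Ux).
  by apply: eq_bigr => p _; rewrite !(christoffel_exp_conformal _ _ _ Ux).
by rewrite diff quad addrA -big_split.
Qed.

(** Functions of xi = [lin_form a] alone: all tensors built from them are
    combinations of a tensor a and h, with coefficients depending on xi. *)
Section Radial.
Variables (u : R -> R).
Hypothesis du : forall t, derivable u t 1.
Local Notation v := (fun x => u (lin_form a x)).

Lemma is_derive_radial1 x i :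
  is_derive x (delta_mx 0 i) v (a 0 i * derive1 u (lin_form a x)).
Proof.
have d t : is_derive t (1 : R) u (derive1 u t).
  by split; [exact: du | rewrite [RHS]derive1E].
exact: is_derive_radial (d _).
Qed.

Lemma dform_radial x : dform v x = derive1 u (lin_form a x) *: a.
Proof.
by apply/rowP => i; rewrite !mxE (partialE (is_derive_radial1 x i)) mulrC.
Qed.

Lemma grad_radial x : U x ->
  grad G v x = (derive1 u (lin_form a x) * expR (- 2 * lin_form a x)) *: a.
Proof.
move=> Ux; rewrite /grad dform_radial invmx_exp_conformal //.
rewrite -scalemxAl -scalemxAr scalerA; congr (_ *: _).
by rewrite -[in LHS](ah Ux) mulmxK // hunit.
Qed.

Hypothesis ddu : forall t, derivable (derive1 u) t 1.
Local Notation u1 x := (derive1 u (lin_form a x)).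
Local Notation u2 x := (derive1 (derive1 u) (lin_form a x)).

Lemma is_derive_radial2 x i :
  is_derive x (delta_mx 0 i) (fun y => u1 y) (a 0 i * u2 x).
Proof.
have d t : is_derive t (1 : R) (derive1 u) (derive1 (derive1 u) t).
  by split; [exact: ddu | rewrite [RHS]derive1E].
exact: is_derive_radial (d _).
Qed.

Lemma hess_radial x : U x ->
  hess G v x = (u2 x - 2 * u1 x) *: (a^T *m a) + u1 x *: h x.
Proof.
move=> Ux; apply/matrixP => i j; rewrite !mxE big_ord1 !mxE.
have -> : partial j v = (fun y => a 0 j * u1 y).
  by apply/funext => y; exact: partialE (is_derive_radial1 y j).
have -> : partial i (fun y => a 0 j * u1 y) x = a 0 j * (a 0 i * u2 x).
  apply/partialE/(is_derive_eq (is_derive_mul (is_derive_const _ _ _)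
    (is_derive_radial2 x i))).
  by rewrite mul0r add0r.
have -> : \sum_k christoffel G k i j x * partial k v x
   = u1 x * \sum_k (a 0 k * christoffel h k i j x
       + (k == i)%:R * (a 0 k * a 0 j) + (k == j)%:R * (a 0 k * a 0 i)
       - h x i j * (a 0 k * a 0 k)).
  rewrite mulr_sumr; apply: eq_bigr => k _.
  rewrite christoffel_exp_conformal // (partialE (is_derive_radial1 x k)).
  by rewrite /conformal_christoffel; ring.
rewrite sumrB !big_split /= !sum_delta -mulr_sumr -/(lin_form a a) aa.
by rewrite parallel_christoffel_up //; ring.
Qed.

Lemma laplacian_radial x : U x ->
  laplacian G v x = expR (- 2 * lin_form a x) * (u2 x + (N%:R - 2) * u1 x).
Proof.
move=> Ux; rewrite /laplacian hess_radial // invmx_exp_conformal //.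
rewrite -scalemxAl mulmxDr -!scalemxAr mulVmx ?hunit // mxtraceZ mxtraceD !mxtraceZ.
have -> : \tr (invmx (h x) *m (a^T *m a)) = 1.
  rewrite -[RHS]aa mxtrace_mulC -mulmxA -[a in a *m invmx _](ah Ux).
  rewrite mulmxK ?hunit // mxtrace_mulC /mxtrace big_ord1 mxE.
  by apply: eq_bigr => i _; rewrite mxE.
by rewrite mxtrace1; ring.
Qed.

Lemma lie_metric_grad_radial x : U x ->
  2^-1 *: lie_metric (grad G v) G x = hess G v x.
Proof.
move=> Ux; rewrite hess_radial //; apply/matrixP => i j.
rewrite !mxE big_ord1 !mxE.
pose E y := expR (- 2 * lin_form a y).
have dX k l : partial l (fun y => grad G v y 0 k) x
   = a 0 l * (u2 x - 2 * u1 x) * E x * a 0 k.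
  apply: partialE.
  apply: (@is_derive_open_eq _ _ U (fun y => u1 y * E y * a 0 k)) => //.
    by move=> y Uy; rewrite grad_radial // !mxE.
  have dE := is_derive_expR_comp (is_derive_mul
    (is_derive_const (- 2) x (delta_mx 0 l))
    (is_derive_linear x _ (lin_form_linear a))).
  apply: is_derive_eq (is_derive_mul (is_derive_mul (is_derive_radial2 x l) dE)
    (is_derive_const _ _ _)) _.
  by rewrite lin_form_delta -/(E x); ring.
transitivity (2^-1 * \sum_k (2 * u1 x * h x i j * (a 0 k * a 0 k)
   + u1 x * (a 0 k * partial k (fun y => h y i j) x)
   + (u2 x - 2 * u1 x) * a 0 i * (a 0 k * h x k j)
   + (u2 x - 2 * u1 x) * a 0 j * (a 0 k * h x k i))).
  congr (_ * _); apply: eq_bigr => k _; rewrite !dX grad_radial // !mxE.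
  rewrite (partialE (is_derive_exp_conformal _ _ _ Ux)) -/(E x).
  rewrite [h x i k]hC //.
  rewrite /E mulNr expRN; move: (partial k _ x) => P.
  by field; rewrite gt_eqF // expR_gt0.
have ahE m : \sum_k a 0 k * h x k m = a 0 m by rewrite -[in RHS](ah Ux) mxE.
rewrite !big_split /= -!mulr_sumr -/(lin_form a a) aa dah // !ahE.
by field.
Qed.

End Radial.

Lemma inner_grad_radial (u w : R -> R) x :
  (forall t, derivable u t 1) -> (forall t, derivable w t 1) -> U x ->
  inner G (grad G (fun y => u (lin_form a y))) (grad G (fun y => w (lin_form a y))) x
  = expR (- 2 * lin_form a x)
    * (derive1 u (lin_form a x) * derive1 w (lin_form a x)).
Proof.
move=> du dw Ux; rewrite /inner !grad_radial // /exp_conformal.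
rewrite -!(scalemxAl, scalemxAr) ah // !(@mxE R 1 1).
have row_aa c : \sum_i a 0 i * (c *: a)^T i 0 = c.
  rewrite -[RHS]mulr1 -aa mulr_sumr.
  by apply: eq_bigr => i _; rewrite !mxE mulrCA.
rewrite row_aa.
by rewrite mulNr expRN; field; rewrite gt_eqF // expR_gt0.
Qed.

End ConformalMetric.

(** * The product of a flat space and a metric *)

Section FlatFactor.
Variables (R : realType) (n m : nat) (V : set 'rV[R]_m).
Variable g : 'rV[R]_m -> 'M[R]_m.
Hypothesis oV : open V.
Hypothesis gunit : forall y, V y -> g y \in unitmx.

Definition flat_sum (z : 'rV[R]_(n + m)) : 'M[R]_(n + m) :=
  block_mx 1%:M 0 0 (g (rsubmx z)).
Local Notation h := flat_sum.
Local Notation ls := (lshift m).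
Local Notation rs := (rshift n).

Let U : set 'rV[R]_(n + m) := rsubmx @^-1` V.

Lemma open_rsubmx_preimage : open U.
Proof. by apply: open_comp => // z _; exact: continuous_rsubmx. Qed.

Lemma flat_sum_ll i j : (fun z => h z (ls i) (ls j)) = fun=> (i == j)%:R.
Proof. by apply/funext => z; rewrite block_mxEul mxE. Qed.

Lemma flat_sum_lr i j : (fun z => h z (ls i) (rs j)) = fun=> 0.
Proof. by apply/funext => z; rewrite block_mxEur mxE. Qed.

Lemma flat_sum_rl i j : (fun z => h z (rs i) (ls j)) = fun=> 0.
Proof. by apply/funext => z; rewrite block_mxEdl mxE. Qed.

Lemma flat_sum_rr i j :
  (fun z => h z (rs i) (rs j)) = (fun y => g y i j) \o rsubmx.
Proof. by apply/funext => z; rewrite block_mxEdr. Qed.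

Lemma partial_const N (k : 'I_N) (c : R) (z : 'rV[R]_N) :
  partial k (fun=> c) z = 0.
Proof. exact: partialE (is_derive_const c z _). Qed.

Lemma partial_flat_sum_lrow k i j z : partial k (fun z => h z (ls i) j) z = 0.
Proof.
by case: (split_ordP j) => p ->; rewrite ?flat_sum_ll ?flat_sum_lr partial_const.
Qed.

Lemma partial_flat_sum_lcol k i j z : partial k (fun z => h z i (ls j)) z = 0.
Proof.
by case: (split_ordP i) => p ->; rewrite ?flat_sum_ll ?flat_sum_rl partial_const.
Qed.

Lemma partial_flat_sum_l k i j z : partial (ls k) (fun z => h z i j) z = 0.
Proof.
case: (split_ordP i) => p ->; first exact: partial_flat_sum_lrow.
case: (split_ordP j) => q ->; first exact: partial_flat_sum_lcol.
by rewrite flat_sum_rr partial_rsubmx_lshift.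
Qed.

Lemma partial_flat_sum_r k i j z :
  partial (rs k) (fun z => h z (rs i) (rs j)) z
  = partial k (fun y => g y i j) (rsubmx z).
Proof. by rewrite flat_sum_rr partial_rsubmx_rshift. Qed.

Lemma flat_sum_unit z : U z -> h z \in unitmx.
Proof.
move=> Uz; rewrite unitmxE det_ublock det1 mul1r -unitmxE; exact: gunit.
Qed.

Lemma invmx_flat_sum z : U z -> invmx (h z) = block_mx 1%:M 0 0 (invmx (g (rsubmx z))).
Proof.
move=> Uz; rewrite /h invmx_block_diag ?invmx1 //.
exact: flat_sum_unit.
Qed.

Lemma christoffel_flat_sum_up z k i j : U z -> christoffel h (ls k) i j z = 0.
Proof.
move=> Uz; rewrite /christoffel invmx_flat_sum // big_split_ord /=.
rewrite !big1 ?addr0 ?mulr0 // => l _.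
  by rewrite block_mxEur mxE mul0r.
by rewrite !partial_flat_sum_lcol partial_flat_sum_l addr0 subr0 mulr0.
Qed.

Lemma christoffel_flat_sum_down1 z k i j : U z -> christoffel h k (ls i) j z = 0.
Proof.
move=> Uz; rewrite /christoffel big1 ?mulr0 // => l _.
by rewrite partial_flat_sum_l !partial_flat_sum_lrow addr0 subr0 mulr0.
Qed.

Lemma christoffel_flat_sum_down2 z k i j : U z -> christoffel h k i (ls j) z = 0.
Proof.
move=> Uz; rewrite /christoffel big1 ?mulr0 // => l _.
rewrite partial_flat_sum_lrow partial_flat_sum_l partial_flat_sum_lcol.
by rewrite addr0 subr0 mulr0.
Qed.

Lemma christoffel_flat_sum z k i j : U z ->
  christoffel h (rs k) (rs i) (rs j) z = christoffel g k i j (rsubmx z).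
Proof.
move=> Uz; rewrite /christoffel invmx_flat_sum // big_split_ord /=.
rewrite big1 ?add0r => [|l _]; last by rewrite block_mxEdl mxE mul0r.
congr (_ * _); apply: eq_bigr => l _.
by rewrite block_mxEdr !partial_flat_sum_r.
Qed.

Let partial0 (w : 'rV[R]_(n + m) -> R) i z : U z -> (forall y, U y -> w y = 0) ->
  partial i w z = 0.
Proof.
move=> Uz w0; rewrite (partial_open_eq i open_rsubmx_preimage w0 Uz).
exact: partial_const.
Qed.

Let partial_christoffel_l l k i j z : U z ->
  partial (ls l) (christoffel h k i j) z = 0.
Proof.
move=> Uz; case: (split_ordP k) => k' ->.
  by apply: partial0 => // y Uy; exact: christoffel_flat_sum_up.
case: (split_ordP i) => i' ->.
  by apply: partial0 => // y Uy; exact: christoffel_flat_sum_down1.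
case: (split_ordP j) => j' ->.
  by apply: partial0 => // y Uy; exact: christoffel_flat_sum_down2.
rewrite (partial_open_eq (v := christoffel g k' i' j' \o rsubmx)
  _ open_rsubmx_preimage _ Uz).
  exact: partial_rsubmx_lshift.
by move=> y Uy; exact: christoffel_flat_sum.
Qed.

Let partial_christoffel_r l k i j z : U z ->
  partial (rs l) (christoffel h (rs k) (rs i) (rs j)) z
  = partial l (christoffel g k i j) (rsubmx z).
Proof.
move=> Uz.
rewrite (partial_open_eq (v := christoffel g k i j \o rsubmx)
  _ open_rsubmx_preimage _ Uz).
  exact: partial_rsubmx_rshift.
by move=> y Uy; exact: christoffel_flat_sum.
Qed.

(** A curvature component of the product with an index in the flat factor
    vanishes: so do the Christoffel symbols with such an index, and the others do
    not depend on the flat coordinates. *)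
Lemma ricci_flat_sum z : U z ->
  ricci h z = block_mx 0 0 0 (ricci g (rsubmx z)).
Proof.
move=> Uz; have up := christoffel_flat_sum_up _ _ _ Uz.
have d1 := christoffel_flat_sum_down1 _ _ _ Uz.
have d2 := christoffel_flat_sum_down2 _ _ _ Uz.
have Rup k i j : riemann h (ls i) k (ls i) j z = 0.
  rewrite /riemann partial_christoffel_l // partial0 // => [|y Uy]; last first.
    exact: christoffel_flat_sum_up.
  by rewrite subrr add0r big1 // => p _; rewrite !up !mul0r subrr.
have Rk l k i j : riemann h l (ls k) i j z = 0.
  rewrite /riemann !partial0 // => [|y Uy|y Uy]; try exact: christoffel_flat_sum_down2.
  by rewrite subrr add0r big1 // => p _; rewrite !d2 !mulr0 subrr.
have Rj l k i j : riemann h l k i (ls j) z = 0.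
  rewrite /riemann partial_christoffel_l // partial0 // => [|y Uy]; last first.
    exact: christoffel_flat_sum_down1.
  by rewrite subrr add0r big1 // => p _; rewrite !d1 mulr0 mul0r subrr.
apply/matrixP => j k; rewrite mxE.
case: (split_ordP j) => j' ->.
  rewrite big1 => [|i _]; last exact: Rj.
  by case: (split_ordP k) => k' ->; rewrite ?block_mxEul ?block_mxEur mxE.
case: (split_ordP k) => k' ->.
  rewrite big1 => [|i _]; last exact: Rk.
  by rewrite block_mxEdl mxE.
rewrite block_mxEdr mxE big_split_ord /= big1 ?add0r => [|i _]; last exact: Rup.
apply: eq_bigr => i _; rewrite /riemann !partial_christoffel_r //; congr (_ + _).
rewrite big_split_ord /= big1 ?add0r => [|p _]; last by rewrite !d2 !mul0r subrr.
by apply: eq_bigr => p _; rewrite !christoffel_flat_sum.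
Qed.

End FlatFactor.

(** * Warped products and conformal spaces are Riemannian manifolds *)

Lemma open_overlap (R : realType) (m : nat) (M : riemannian_data R m)
    (a b : chart M) : smooth_manifold M -> open (overlap a b).
Proof.
case=> _ _ _ charts _.
have [_ oa aK _ cparam] := charts a; have [ob _ _ _ _] := charts b.
rewrite openE => x [p [pa pb] <-].
have ca : cimage a (Defs.coord a p) by exists p.
have n1 : nbhs (Defs.coord a p) (cimage a) by exact: open_nbhs_nbhs.
have n2 : nbhs (Defs.coord a p) (param a @^-1` cdom b).
  by apply: (cparam _ ca); apply: open_nbhs_nbhs; rewrite aK.
apply: filterS (filterI n1 n2) => y [[q qa <-] /=]; rewrite aK // => qb.
by exists q.
Qed.

Lemma riemannian_metric_unit (R : realType) (m : nat) (M : riemannian_data R m)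
    (a : chart M) x : riemannian_manifold M -> cimage a x -> gmat a x \in unitmx.
Proof.
case=> _ _ pos _ ax; have [_ {}pos] := pos a x ax.
rewrite -row_free_unit; apply/inj_row_free => v vg.
apply/eqP/negPn/negP => /pos; rewrite vg mul0mx mxE ltxx; exact/negP.
Qed.

Section WarpedProductManifold.
Variables (R : realType) (n m : nat).
Variables (B : riemannian_data R n) (F : riemannian_data R m) (f : B -> R).
Hypothesis hB : riemannian_manifold B.
Hypothesis hF : riemannian_manifold F.
Local Notation W := (warped_product F f).

Lemma cimage_warped (a : chart W) z :
  cimage a z <-> cimage a.1 (lsubmx z) /\ cimage a.2 (rsubmx z).
Proof.
split=> [[p [/= p1 p2] <-]|[[p pa pz] [q qb qz]]].
  by rewrite row_mxKl row_mxKr; split; [exists p.1|exists p.2].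
by exists (p, q) => //=; rewrite pz qz hsubmxK.
Qed.

Lemma overlap_warped (a b : chart W) z : overlap a b z <->
  overlap a.1 b.1 (lsubmx z) /\ overlap a.2 b.2 (rsubmx z).
Proof.
split=> [[p [[/= p1 p2] [/= p3 p4]] <-]|[[p [pa pb] pz] [q [qa qb] qz]]].
  by rewrite row_mxKl row_mxKr; split; [exists p.1|exists p.2].
by exists (p, q) => //=; rewrite pz qz hsubmxK.
Qed.

Lemma open_cimage_warped (a : chart W) : open (cimage a).
Proof.
have [[_ _ _ cB _] _ _ _] := hB; have [[_ _ _ cF _] _ _ _] := hF.
have -> : cimage a = lsubmx @^-1` cimage a.1 `&` rsubmx @^-1` cimage a.2.
  by apply/seteqP; split=> z /cimage_warped.
have [_ o1 _ _ _] := cB a.1; have [_ o2 _ _ _] := cF a.2.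
apply: openI; apply: open_comp => // z _.
  exact: continuous_lsubmx.
exact: continuous_rsubmx.
Qed.

Lemma open_overlap_warped (a b : chart W) : open (overlap a b).
Proof.
have [mB _ _ _] := hB; have [mF _ _ _] := hF.
have -> : overlap a b = lsubmx @^-1` overlap a.1 b.1 `&` rsubmx @^-1` overlap a.2 b.2.
  by apply/seteqP; split=> z /overlap_warped.
apply: openI; apply: open_comp; try exact: open_overlap.
  by move=> z _; exact: continuous_lsubmx.
by move=> z _; exact: continuous_rsubmx.
Qed.

Lemma transition_warped (a b : chart W) z : transition a b z
  = row_mx (transition a.1 b.1 (lsubmx z)) (transition a.2 b.2 (rsubmx z)).
Proof. by []. Qed.

Lemma transition_warped_l (a b : chart W) j :
  (fun z => transition a b z 0 (lshift m j))
  = (fun x => transition a.1 b.1 x 0 j) \o lsubmx.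
Proof. by apply/funext => z; rewrite transition_warped row_mxEl. Qed.

Lemma transition_warped_r (a b : chart W) j :
  (fun z => transition a b z 0 (rshift n j))
  = (fun x => transition a.2 b.2 x 0 j) \o rsubmx.
Proof. by apply/funext => z; rewrite transition_warped row_mxEr. Qed.

Lemma jac_transition_warped (a b : chart W) z : jac (transition a b) z
  = block_mx (jac (transition a.1 b.1) (lsubmx z)) 0
             0 (jac (transition a.2 b.2) (rsubmx z)).
Proof.
apply/matrixP => i j; rewrite mxE.
case: (split_ordP j) => j' ->; rewrite ?transition_warped_l ?transition_warped_r;
  case: (split_ordP i) => i' ->.
- by rewrite partial_lsubmx_lshift block_mxEul mxE.
- by rewrite partial_lsubmx_rshift block_mxEdl mxE.
- by rewrite partial_rsubmx_lshift block_mxEur mxE.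
- by rewrite partial_rsubmx_rshift block_mxEdr mxE.
Qed.

Lemma smooth_manifold_warped : smooth_manifold W.
Proof.
have [[hausB scB coverB chartB transB] _ _ _] := hB.
have [[hausF scF coverF chartF transF] _ _ _] := hF.
split.
- exact: hausdorff_prod.
- exact: second_countable_prod.
- move=> [p q]; have [a pa] := coverB p; have [b qb] := coverF q.
  by exists (a, b).
- move=> [a b]; have [oa oia Ka ca pa] := chartB a.
  have [ob oib Kb cb pb] := chartF b; split.
  + exact: open_setX.
  + exact: open_cimage_warped.
  + by move=> [p q] [/= ap bq]; rewrite row_mxKl row_mxKr Ka // Kb.
  + move=> [p q] [/= ap bq]; apply: continuous_row_mx.
      apply: (@continuous_comp _ _ _ fst (Defs.coord a)); first exact: cvg_fst.
      exact: ca.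
    apply: (@continuous_comp _ _ _ snd (Defs.coord b)); first exact: cvg_snd.
    exact: cb.
  + move=> z /cimage_warped[/= za zb].
    apply: continuous_pair.
      apply: (@continuous_comp _ _ _ lsubmx (param a)); last exact: pa.
      exact: continuous_lsubmx.
    apply: (@continuous_comp _ _ _ rsubmx (param b)); last exact: pb.
    exact: continuous_rsubmx.
- move=> a b j; have oab := @open_overlap_warped a b.
  case: (split_ordP j) => i ->.
    rewrite transition_warped_l; apply: smooth_lsubmx (transB a.1 b.1 i) => //.
    by move=> z /overlap_warped[].
  rewrite transition_warped_r; apply: smooth_rsubmx (transF a.2 b.2 i) => //.
  by move=> z /overlap_warped[].
Qed.

Hypothesis smooth_f : smooth_fun f.
Hypothesis f_gt0 : forall p, 0 < f p.

Lemma riemannian_manifold_warped : riemannian_manifold W.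
Proof.
have [mB sB pB tB] := hB; have [mF sF pF tF] := hF.
have [_ _ _ chartB _] := mB.
split; first exact: smooth_manifold_warped.
- move=> a i j; have oa := @open_cimage_warped a.
  have pl z : cimage a z -> cimage a.1 (lsubmx z) by move/cimage_warped => [].
  have pr z : cimage a z -> cimage a.2 (rsubmx z) by move/cimage_warped => [].
  case: (split_ordP i) => i' ->; case: (split_ordP j) => j' ->.
  + apply: smooth_open_eq oa _ (smooth_lsubmx oa pl (sB a.1 i' j')) => z _.
    by rewrite /= block_mxEul.
  + apply: smooth_open_eq oa _ (smooth_cst 0 oa) => z _.
    by rewrite /= block_mxEur mxE.
  + apply: smooth_open_eq oa _ (smooth_cst 0 oa) => z _.
    by rewrite /= block_mxEdl mxE.
  + have sf := smooth_lsubmx oa pl (smooth_f a.1).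
    have := smoothM oa (smoothM oa sf sf) (smooth_rsubmx oa pr (sF a.2 i' j')).
    apply: smooth_open_eq => // z _.
    by rewrite /= block_mxEdr mxE expr2.
- move=> a z /cimage_warped[za zb].
  have [symB posB] := pB _ _ za; have [symF posF] := pF _ _ zb.
  split=> /= [|v v0]; first by rewrite tr_block_mx !trmx0 linearZ /= symB symF.
  rewrite -[v]hsubmxK mul_row_block !mulmx0 addr0 add0r tr_row_mx mul_row_col.
  rewrite mxE -scalemxAr -scalemxAl [X in _ + X]mxE.
  have nnegB : 0 <= (lsubmx v *m gmat a.1 (lsubmx z) *m (lsubmx v)^T) 0 0.
    by have [->|/posB/ltW//] := eqVneq (lsubmx v) 0; rewrite !mul0mx mxE.
  have nnegF : 0 <= (rsubmx v *m gmat a.2 (rsubmx z) *m (rsubmx v)^T) 0 0.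
    by have [->|/posF/ltW//] := eqVneq (rsubmx v) 0; rewrite !mul0mx mxE.
  have f0 : 0 < f (param a.1 (lsubmx z)) ^+ 2 by rewrite exprn_gt0.
  have [l0|/posB lpos] := eqVneq (lsubmx v) 0; last first.
    by rewrite ltr_pwDl // mulr_ge0 // ltW.
  have r0 : rsubmx v != 0.
    apply: contra_neq v0 => r0; by rewrite -[v]hsubmxK l0 r0 row_mx0.
  by rewrite ltr_wpDl // mulr_gt0 //; exact: posF.
- move=> a b z /overlap_warped[zl zr].
  rewrite jac_transition_warped transition_warped /= row_mxKl row_mxKr.
  rewrite tr_block_mx !trmx0 !mulmx_block !(mulmx0, mul0mx, addr0, add0r).
  rewrite -scalemxAr -scalemxAl -tB // -tF //; congr (block_mx _ _ _ (f _ ^+ 2 *: _)).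
  move: zl => [p [pa pb] <-]; rewrite /transition.
  have [_ _ Ka _ _] := chartB a.1; have [_ _ Kb _ _] := chartB b.1.
  by rewrite Ka // Kb.
Qed.

End WarpedProductManifold.

Section ConformalSpaceManifold.
Variables (R : realType) (n : nat) (xi : 'rV[R]_n -> R).
Hypothesis smooth_xi : smooth_on setT xi.
Local Notation S := (conformal_space xi).

Lemma cimage_conformal (a : chart S) : cimage a = setT.
Proof. by apply/seteqP; split=> // x _; exists x. Qed.

Lemma jac_id (x : 'rV[R]_n) : jac id x = 1%:M.
Proof.
apply/matrixP => i j; rewrite !mxE; apply: partialE.
have -> : (i == j)%:R = (delta_mx 0 i : 'rV[R]_n) 0 j by rewrite mxE eq_sym.
by apply: (@is_derive_linear _ _ (fun y => y 0 j)) => c y z; rewrite !mxE.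
Qed.

Lemma riemannian_manifold_conformal : riemannian_manifold S.
Proof.
have oT := @openT 'rV[R]_n.
split.
- split.
  + exact: norm_hausdorff.
  + exact: second_countable_rV.
  + by move=> p; exists tt.
  + move=> a; rewrite cimage_conformal; split; [exact: openT|exact: openT|by []|..];
      move=> x _; exact: cvg_id.
  + move=> a b j; rewrite (_ : overlap a b = setT); first exact: smooth_coord.
    by apply/seteqP; split=> // x _; exists x.
- move=> a i j; rewrite cimage_conformal.
  apply: (@smooth_open_eq _ _ _ (fun x => expR (2 * xi x) * (i == j)%:R)) => //.
    by move=> x _; rewrite /= /conformal_metric mxE mulr_natr.
  apply: smoothM => //; last exact: smooth_cst.
  apply: smooth_expR => //; apply: smoothM => //; exact: smooth_cst.
- move=> a x _ /=; rewrite /conformal_metric tr_scalar_mx; split=> // v v0.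
  rewrite mul_mx_scalar -scalemxAl mxE mulr_gt0 ?expR_gt0 // mxE.
  have [i vi] : exists i, v 0 i != 0.
    apply/existsP; apply: contra_neqT v0; rewrite negb_exists => /forallP v0.
    by apply/rowP => i; rewrite mxE; apply/eqP; rewrite -[_ == _]negbK v0.
  rewrite (bigD1 i) //= ltr_pwDl //.
    by rewrite mxE -expr2 lt_neqAle sqr_ge0 eq_sym sqrf_eq0 vi.
  by apply: sumr_ge0 => j _; rewrite mxE -expr2 sqr_ge0.
- move=> a b x _ /=; rewrite (_ : transition a b = id) // jac_id.
  by rewrite mul1mx trmx1 mulmx1.
Qed.

End ConformalSpaceManifold.

(** * The potential and the soliton function *)

Section Profiles.
Variables (R : realType).

Lemma derivable_derive1 (u du : R -> R) :
  (forall t : R, is_derive t (1 : R) u (du t)) ->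
  (forall t : R, derivable u t 1) /\ derive1 u = du.
Proof.
move=> hu; split=> [t|]; first by case: (hu t).
by apply/funext => t; rewrite derive1E; case: (hu t).
Qed.

Lemma is_derive_expRM (c t : R) :
  is_derive t (1 : R) (fun s => expR (c * s)) (c * expR (c * t)).
Proof.
apply: is_derive_expR_comp.
apply: is_derive_eq (is_derive_mul (is_derive_const c t 1) (is_derive_id t 1)) _.
by rewrite mul0r add0r mulr1.
Qed.

(** This family is closed under differentiation and contains all the functions
    of xi whose derivatives are needed, apart from the warping function. *)
Definition profile (p q r s t : R) : R :=
  p * expR (2 * t) + q * t + r * expR (- 2 * t) + s.

Lemma is_derive_profile p q r s t :
  is_derive t (1 : R) (profile p q r s) (profile (2 * p) 0 (- 2 * r) q t).
Proof.
have Z c d (w : R -> R) : is_derive t (1 : R) w d ->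
    is_derive t (1 : R) (fun s => c * w s) (c * d).
  move=> hw; apply: is_derive_eq (is_derive_mul (is_derive_const c t 1) hw) _.
  by rewrite mul0r add0r.
have d1 := Z p _ _ (is_derive_expRM 2 t).
have d2 := Z q _ _ (is_derive_id t 1).
have d3 := Z r _ _ (is_derive_expRM (- 2) t).
apply: is_derive_eq (is_derive_add (is_derive_add (is_derive_add d1 d2) d3)
  (is_derive_const s t 1)) _.
by rewrite /profile; ring.
Qed.

Lemma derivable_profile p q r s t : derivable (profile p q r s) t 1.
Proof. by case: (is_derive_profile p q r s t). Qed.

Lemma derive1_profile p q r s :
  derive1 (profile p q r s) = profile (2 * p) 0 (- 2 * r) q.
Proof. exact: (derivable_derive1 (is_derive_profile p q r s)).2. Qed.

Lemma smooth_profile n (U : set 'rV[R]_n) a p q r s : open U ->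
  smooth_on U (fun x => profile p q r s (lin_form a x)).
Proof.
move=> oU; have cst c := smooth_cst c oU.
have lin := smooth_lin_form a oU.
have ex c := smooth_expR oU (smoothM oU (cst c) lin).
exact: smoothD oU (smoothD oU (smoothD oU (smoothM oU (cst p) (ex 2))
  (smoothM oU (cst q) lin)) (smoothM oU (cst r) (ex (- 2)))) (cst s).
Qed.

End Profiles.

Section FlatMetric.
Variables (R : realType) (n : nat).

Lemma christoffel_flat k i j :
  christoffel (fun=> 1%:M : 'M[R]_n) k i j = fun=> 0.
Proof.
apply/funext => x; rewrite /christoffel big1 ?mulr0 // => l _.
by rewrite !partial_const addr0 subr0 mulr0.
Qed.

Lemma ricci_flat_metric x : ricci (fun=> 1%:M : 'M[R]_n) x = 0.
Proof.
apply/matrixP => j k; rewrite !mxE big1 // => i _.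
rewrite /riemann !christoffel_flat !partial_const subr0 add0r big1 // => p _.
by rewrite !christoffel_flat mulr0 subrr.
Qed.

End FlatMetric.

Section SolitonFunctions.
Variables (R : realType) (n m : nat) (c1 c2 : R).

Definition kappa : R := (2 - m%:R - n%:R) / 2.

Definition potential_profile : R -> R := profile (c1 / 2) (- kappa) 0 c2.
Definition soliton_profile : R -> R := profile 0 0 kappa c1.

Lemma derive1_potential t : derive1 potential_profile t = c1 * expR (2 * t) - kappa.
Proof. by rewrite derive1_profile /profile; field. Qed.

Lemma derive2_potential t :
  derive1 (derive1 potential_profile) t = 2 * c1 * expR (2 * t).
Proof. by rewrite !derive1_profile /profile; field. Qed.

Lemma derivable_potential t : derivable potential_profile t 1.
Proof. exact: derivable_profile. Qed.

Lemma derivable_derive1_potential t : derivable (derive1 potential_profile) t 1.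
Proof. by rewrite derive1_profile; exact: derivable_profile. Qed.

End SolitonFunctions.

(** For the metric exp (2 xi) h, Ric contributes (N - 2) (a tensor a - h) and the
    Hessian of the potential contributes (2 - m - n) a tensor a plus a multiple
    of h.  When N = n + m the two rank one terms cancel, which gives the soliton
    equation on the warped product; when N = n, what is left is the Hessian term
    m / f of the warping function. *)
Lemma soliton_equation (R : realType) (N : nat) (U : set 'rV[R]_N)
    (a : 'rV[R]_N) (h : 'rV[R]_N -> 'M[R]_N) (n m : nat) (c1 c2 : R) x :
  unit_parallel U a h -> U x -> ricci h x = 0 ->
  ricci (exp_conformal a h) x
  + hess (exp_conformal a h) (fun y => potential_profile n m c1 c2 (lin_form a y)) x
  = soliton_profile n m c1 (lin_form a x) *: exp_conformal a h x
    + (N%:R - (n + m)%:R) *: (a^T *m a - h x).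
Proof.
move=> par Ux ric0.
rewrite (ricci_exp_conformal par Ux) ric0 add0r.
rewrite (hess_radial par (@derivable_potential R n m c1 c2)
  (@derivable_derive1_potential R n m c1 c2) Ux).
rewrite derive1_potential derive2_potential /exp_conformal.
apply/matrixP => i j; rewrite !mxE.
move: (\sum_ _ _) (h x i j) => P H.
rewrite /soliton_profile /profile /kappa mulNr expRN natrD.
by field; rewrite gt_eqF // expR_gt0.
Qed.

(** * The warped product over the conformally flat space *)

Section FlatFactorParallel.
Variables (R : realType) (n m : nat) (V : set 'rV[R]_m) (g : 'rV[R]_m -> 'M[R]_m).
Variable alpha : 'rV[R]_n.

Lemma lin_form_row_mx0 (z : 'rV[R]_(n + m)) :
  lin_form (row_mx alpha 0) z = lin_form alpha (lsubmx z).
Proof.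
rewrite /lin_form big_split_ord /= [X in _ + X]big1 ?addr0 => [|i _].
  by apply: eq_bigr => i _; rewrite row_mxEl mxE.
by rewrite row_mxEr mxE mul0r.
Qed.

Lemma unit_parallel_flat_sum : open V ->
  (forall y, V y -> (g y)^T = g y) -> (forall y, V y -> g y \in unitmx) ->
  (forall i j, smooth_on V (fun y => g y i j)) -> lin_form alpha alpha = 1 ->
  unit_parallel (rsubmx @^-1` V) (row_mx alpha 0) (@flat_sum R n m g).
Proof.
move=> oV gsym gunit gsm aa; have oU := @open_rsubmx_preimage R n m V oV.
split=> // [z Vz|z Vz|i j|z Vz|z i j Vz|].
- by rewrite /flat_sum tr_block_mx !trmx0 trmx1 gsym.
- exact: (flat_sum_unit gunit).
- case: (split_ordP i) => i' ->; case: (split_ordP j) => j' ->.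
  + by rewrite flat_sum_ll; exact: smooth_cst.
  + by rewrite flat_sum_lr; exact: smooth_cst.
  + by rewrite flat_sum_rl; exact: smooth_cst.
  + by rewrite flat_sum_rr; apply: smooth_rsubmx (gsm i' j').
- by rewrite mul_row_block !(mulmx0, mul0mx, addr0) mulmx1.
- rewrite big_split_ord /= !big1 ?addr0 // => k _.
    by rewrite row_mxEr mxE mul0r.
  by rewrite partial_flat_sum_l mulr0.
- by rewrite lin_form_row_mx0 row_mxKl.
Qed.

End FlatFactorParallel.

Section WarpedSoliton.
Variables (R : realType) (n m : nat) (alpha : 'rV[R]_n) (c1 c2 : R).
Hypothesis aa : lin_form alpha alpha = 1.
Variable F : riemannian_data R m.
Hypothesis hF : riemannian_manifold F.
Hypothesis flatF : ricci_flat F.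
Local Notation B := (conformal_space (lin_form alpha)).
Let f : B -> R := fun x => expR (lin_form alpha x).
Local Notation W := (warped_product F f).
Local Notation A := (row_mx alpha 0 : 'rV[R]_(n + m)).
Let psi : W -> R :=
  lift_base (fun x : B => potential_profile n m c1 c2 (lin_form alpha x)).
Let lam : W -> R :=
  lift_base (fun x : B => soliton_profile n m c1 (lin_form alpha x)).

Lemma riemannian_base : riemannian_manifold B.
Proof.
by apply: riemannian_manifold_conformal; apply: smooth_lin_form; exact: openT.
Qed.

Lemma smooth_fun_warping : smooth_fun f.
Proof.
move=> a; rewrite cimage_conformal; apply: smooth_expR; first exact: openT.
by apply: smooth_lin_form; exact: openT.
Qed.

Lemma warping_gt0 (p : B) : 0 < f p. Proof. exact: expR_gt0. Qed.

Lemma cimage_warped_conformal (ab : chart W) :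
  cimage ab = rsubmx @^-1` cimage ab.2.
Proof.
apply/seteqP; split=> z; first by move/cimage_warped => [].
by move=> zb; apply/cimage_warped; rewrite cimage_conformal.
Qed.

(** Since f ^ 2 = exp (2 xi) is also the conformal factor of the base, the warped
    metric is conformal to the Riemannian product of the flat base with F. *)
Lemma gmat_warped (ab : chart W) :
  gmat ab = exp_conformal A (flat_sum (gmat ab.2)).
Proof.
apply/funext => z; rewrite /exp_conformal /flat_sum /= scale_block_mx !scaler0.
by rewrite lin_form_row_mx0 scalemx1 /f /conformal_metric expRM_natl.
Qed.

Lemma local_rep_psi (ab : chart W) :
  local_rep psi ab = fun z => potential_profile n m c1 c2 (lin_form A z).
Proof. by apply/funext => z; rewrite lin_form_row_mx0. Qed.

Lemma local_rep_lam (ab : chart W) :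
  local_rep lam ab = fun z => soliton_profile n m c1 (lin_form A z).
Proof. by apply/funext => z; rewrite lin_form_row_mx0. Qed.

Lemma unit_parallel_warped (ab : chart W) :
  unit_parallel (cimage ab) A (flat_sum (gmat ab.2)).
Proof.
have [[_ _ _ chartF _] smF posF _] := hF.
rewrite cimage_warped_conformal; apply: unit_parallel_flat_sum => //.
- by have [] := chartF ab.2.
- by move=> y /posF[].
- by move=> y; exact: riemannian_metric_unit.
Qed.

Lemma gradient_psi (ab : chart W) z : cimage ab z ->
  gradient psi ab z = (derive1 (potential_profile n m c1 c2) (lin_form A z)
                       * expR (- 2 * lin_form A z)) *: A.
Proof.
move=> Uz; rewrite /gradient local_rep_psi gmat_warped.
by rewrite (grad_radial (unit_parallel_warped ab) _ Uz) //; exact: derivable_potential.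
Qed.

Lemma smooth_gradient_psi : smooth_vector_field (gradient psi).
Proof.
split=> [ab i|ab ab' z /overlap_warped[zl zr]].
  have oU := up_open (unit_parallel_warped ab).
  have lin := smooth_lin_form A oU.
  have cst c := smooth_cst c oU.
  apply: smooth_open_eq oU _ (smoothM oU (smoothM oU
    (smooth_profile A (2 * (c1 / 2)) 0 (- 2 * 0) (- kappa R n m) oU)
    (smooth_expR oU (smoothM oU (cst (- 2)) lin))) (cst (A 0 i))) => z Uz.
  by rewrite gradient_psi // /potential_profile derive1_profile [RHS]mxE.
have az : cimage ab z.
  by rewrite cimage_warped_conformal; case: zr => q [qa _] qz; exists q.
have bz : cimage ab' (transition ab ab' z).
  rewrite cimage_warped_conformal.
  change (cimage ab'.2 (rsubmx (transition ab ab' z))).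
  rewrite transition_warped row_mxKr.
  have [[_ _ _ chartF _] _ _ _] := hF; have [_ _ qK _ _] := chartF ab.2.
  by case: zr => q [qa qb] <-; exists q; rewrite // /transition qK.
rewrite !gradient_psi // jac_transition_warped -scalemxAl.
have jac1 : jac (transition ab.1 ab'.1) (lsubmx z) = 1%:M by exact: jac_id.
rewrite mul_row_block !(mulmx0, mul0mx, addr0) jac1 mulmx1.
by rewrite !lin_form_row_mx0 transition_warped row_mxKl.
Qed.

Lemma warped_soliton : gradient_ricci_almost_soliton_warped_product psi lam.
Proof.
split.
- exact: riemannian_base.
- exact: hF.
- exact: smooth_fun_warping.
- exact: warping_gt0.
split.
  move=> ab; rewrite local_rep_psi; apply: smooth_profile.
  exact: up_open (unit_parallel_warped ab).
split.
- exact: riemannian_manifold_warped riemannian_base hF smooth_fun_warping warping_gt0.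
- exact: smooth_gradient_psi.
- move=> ab; rewrite local_rep_lam; apply: smooth_profile.
  exact: up_open (unit_parallel_warped ab).
move=> ab z Uz; have par := unit_parallel_warped ab.
have ric0 : ricci (@flat_sum R n m (gmat ab.2)) z = 0.
  have zb : cimage ab.2 (rsubmx z) by rewrite cimage_warped_conformal in Uz.
  have [[_ _ _ chartF _] _ _ _] := hF; have [_ oV _ _ _] := chartF ab.2.
  rewrite (ricci_flat_sum oV) // ?flatF ?block_mx0 //.
  by move=> y; exact: riemannian_metric_unit.
rewrite /gradient local_rep_psi local_rep_lam gmat_warped.
rewrite (lie_metric_grad_radial par (@derivable_potential R n m c1 c2)
  (@derivable_derive1_potential R n m c1 c2) Uz).
by rewrite (soliton_equation n m c1 c2 par Uz ric0) subrr scale0r addr0.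
Qed.

End WarpedSoliton.

Theorem corollary1 (R : realType) (n m : nat) (hn : (3 <= n)%N)
    (alpha : 'rV[R]_n) (halpha : \sum_(i < n) alpha 0 i ^+ 2 = 1)
    (c1 c2 : R) :
  let xi := fun x : 'rV[R]_n => \sum_(i < n) alpha 0 i * x 0 i in
  let g := conformal_metric xi in
  let f := fun x : 'rV[R]_n => expR (xi x) in
  let phi := fun x : 'rV[R]_n =>
    c1 / 2 * expR (2 * xi x) - (2 - m%:R - n%:R) / 2 * xi x + c2 in
  let lambda := fun x : 'rV[R]_n =>
    c1 + (2 - m%:R - n%:R) / 2 * expR (- 2 * xi x) in
  [/\ forall x : 'rV[R]_n,
        ricci g x + hess g phi x
        = lambda x *: g x + (m%:R / f x) *: hess g f x,
      forall x : 'rV[R]_n,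
        - (2 * lambda x) *: dform phi x
        + dform (fun y => (2 - m%:R - n%:R) * lambda y
                          + inner g (grad g phi) (grad g phi) y
                          - laplacian g phi y
                          - m%:R / f y * inner g (grad g phi) (grad g f) y) x
        = 0,
      forall x : 'rV[R]_n,
        lambda x * f x ^+ 2 + f x * laplacian g f x
        + (m%:R - 1) * inner g (grad g f) (grad g f) x
        - f x * inner g (grad g phi) (grad g f) x = 0
    & forall F : riemannian_data R m,
        (1 < m)%N -> riemannian_manifold F -> complete F -> ricci_flat F ->
        @gradient_ricci_almost_soliton_warped_product R n m
          (conformal_space xi) F f
          (@lift_base R n m (conformal_space xi) F f phi)
          (@lift_base R n m (conformal_space xi) F f lambda)].
Proof.
move=> xi g f phi lambda.
have aa : lin_form alpha alpha = 1.
  by rewrite -halpha; apply: eq_bigr => i _; rewrite expr2.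
have xiE : xi = lin_form alpha by [].
pose h1 : 'rV[R]_n -> 'M[R]_n := fun=> 1%:M.
have gE : g = exp_conformal alpha h1.
  by apply/funext => x; rewrite /exp_conformal scalemx1.
have phiE : phi = fun x => potential_profile n m c1 c2 (lin_form alpha x).
  by apply/funext => x; rewrite /phi xiE /potential_profile /profile /kappa; ring.
have lambdaE : lambda = fun x => soliton_profile n m c1 (lin_form alpha x).
  by apply/funext => x; rewrite /lambda xiE /soliton_profile /profile /kappa; ring.
have fE : f = fun x => expR (lin_form alpha x) by [].
have [dexp expE] := derivable_derive1 (@is_derive_expR R).
have ddexp t : derivable (derive1 (@expR R)) t 1 by rewrite expE.
have dphi1 := @derivable_potential R n m c1 c2.
have dphi2 := @derivable_derive1_potential R n m c1 c2.
have oT := @openT 'rV[R]_n.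
have par1 : unit_parallel setT alpha h1.
  split=> // [x _|x _|i j|x _|x i j _].
  - by rewrite trmx1.
  - by rewrite unitmx1.
  - exact: smooth_cst.
  - by rewrite mulmx1.
  - by rewrite big1 // => k _; rewrite partial_const mulr0.
have lap u := laplacian_radial par1 (u := u).
have inn u w x du dw := inner_grad_radial par1
  (u := u) (w := w) (x := x) du dw I.
have E0 t : expR t != 0 :> R by rewrite gt_eqF // expR_gt0.
have E2 t : expR (2 * t) = expR t ^+ 2 :> R by rewrite expRM_natl.
have EN2 t : expR (- 2 * t) = (expR t ^+ 2)^-1 :> R by rewrite mulNr expRN E2.
split.
- move=> x; rewrite gE phiE lambdaE fE.
  rewrite (soliton_equation n m c1 c2 par1 I (ricci_flat_metric x)).
  rewrite (hess_radial par1 dexp ddexp I) !expE.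
  congr (_ + _); rewrite [RHS]scalerDr !scalerA scalerBr natrD -scaleNr.
  by congr (_ *: _ + _ *: _); field; exact: E0.
- move=> x.
  (* With k = - kappa and E = exp (2 xi), the differentiated function is
     c1 ^ 2 E + k ^ 2 / E - (2 k + 2) c1. *)
  pose q := profile (c1 ^+ 2) 0 (kappa R n m ^+ 2) (- (2 - 2 * kappa R n m) * c1).
  have -> : (fun y => (2 - m%:R - n%:R) * lambda y
                + inner g (grad g phi) (grad g phi) y - laplacian g phi y
                - m%:R / f y * inner g (grad g phi) (grad g f) y)
      = fun y => q (lin_form alpha y).
    apply/funext => y; rewrite gE phiE lambdaE fE.
    rewrite (inn _ _ y dphi1 dphi1) (inn _ _ y dphi1 dexp) (lap _ dphi1 dphi2 y I).
    rewrite expE !derive1_potential derive2_potential.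
    rewrite /q /soliton_profile /profile /kappa !E2 !EN2.
    by move: (E0 (lin_form alpha y)); move: (expR _) => e e0; field.
  have dq t : derivable q t 1 by exact: derivable_profile.
  rewrite phiE lambdaE !dform_radial //.
  rewrite scalerA -scalerDl derive1_potential /q derive1_profile /profile.
  rewrite [X in X *: _](_ : _ = 0) ?scale0r // /soliton_profile /profile !E2 !EN2.
  by move: (E0 (lin_form alpha x)); move: (expR _) => e e0; field.
- move=> x; rewrite gE phiE lambdaE fE (lap _ dexp ddexp x I) (inn _ _ x dexp dexp).
  rewrite (inn _ _ x dphi1 dexp) !expE derive1_potential.
  rewrite /soliton_profile /profile /kappa !E2 !EN2.
  by move: (E0 (lin_form alpha x)); move: (expR _) => e e0; field.
- move=> F _ hF _ flatF; rewrite phiE lambdaE; exact: warped_soliton.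
Qed.
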